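(* Let $\{n_k\mid k\ge 1\}$ be a strictly increasing sequence of positive integers and $\{\Lambda_{n_k}\mid k\ge 1\}$ a sequence of differential operators in $\mathbb{D}_2$ with $\mathrm{rank}(\Lambda_{n_k})=n_k$ for all $k\ge 1$. Suppose that, for every $k\ge 1$, $\mathbf{HVC}[N_k]$ holds for $\Lambda_{n_k}$ for some $N_k\ge n_k$ (with $\Lambda_{n_k}\in\mathbb{D}_2[N_k]$). Then the following (mutually equivalent) statements all hold: (1) the Jacobian conjecture $\mathbf{JC}$; (2) for every $n\ge1$, $\mathbf{HVC}[n]$ holds for $\Delta_n=\sum_{i=1}^nD_i^2$; (3) for every $n\ge1$, $\mathbf{VC}[n]$ holds for $\Delta_n$; (4) for every $n\ge1$, $\mathbf{HVC}[n]$ holds for all $\Lambda\in\mathbb{D}_2[n]$; (5) for every $n\ge1$, $\mathbf{VC}[n]$ holds for all $\Lambda\in\mathbb{D}_2[n]$.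
   Context: $\mathcal{A}_n=\mathbb{C}[z_1,\dots,z_n]$ and $D_i=\partial/\partial z_i$. $\mathbb{D}_2[n]$ is the set of homogeneous second order differential operators with constant complex coefficients in $D_1,\dots,D_n$; each is uniquely of the form $\Delta_A=\sum_{i,j=1}^n a_{ij}D_iD_j$ with $A=(a_{ij})$ a symmetric complex $n\times n$ matrix, and its rank is the rank of $A$. $\mathbb{D}_2=\bigcup_{n\ge1}\mathbb{D}_2[n]$. For a differential operator $\Lambda$ of $\mathcal{A}_n$, $P\in\mathcal{A}_n$ is $\Lambda$-nilpotent if $\Lambda^m(P^m)=0$ for all $m\ge 1$. ''$\mathbf{VC}[n]$ holds for $\Lambda$'' means: for every $\Lambda$-nilpotent $P\in\mathcal{A}_n$, $\Lambda^m(P^{m+1})=0$ for all sufficiently large $m$. ''$\mathbf{HVC}[n]$ holds for $\Lambda$'' means the same, but only for homogeneous $\Lambda$-nilpotent $P\in\mathcal{A}_n$. $\mathbf{JC}$ is the statement: for every $n\ge 1$ and every polynomial map $F$ of $\mathbb{C}^n$ with Jacobian determinant $j(F)=1$, the formal inverse map of $F$ is also a polynomial map. *)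

(* Defs.v *)
From HB Require Import structures.
From mathcomp Require Import all_boot all_order all_algebra.
From mathcomp Require Import reals complex mpoly.

Set Implicit Arguments.
Unset Strict Implicit.
Unset Printing Implicit Defensive.

Import GRing.Theory.
Local Open Scope ring_scope.

(* For R : realType, R[i] is the field of complex numbers, so {mpoly R[i][n]} *)
(* is the polynomial algebra A_n and P^`M(i) is the partial derivative D_i P. *)

Definition nilpotent_for (R : realType) (n : nat)
    (L : {mpoly R[i][n]} -> {mpoly R[i][n]}) (P : {mpoly R[i][n]}) : Prop :=
  forall m : nat, (0 < m)%N -> iter m L (P ^+ m) = 0.

Definition eventually_vanishing (R : realType) (n : nat)
    (L : {mpoly R[i][n]} -> {mpoly R[i][n]}) (P : {mpoly R[i][n]}) : Prop :=
  exists M : nat, forall m : nat, (M <= m)%N -> iter m L (P ^+ m.+1) = 0.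

Definition VC (R : realType) (n : nat)
    (L : {mpoly R[i][n]} -> {mpoly R[i][n]}) : Prop :=
  forall P : {mpoly R[i][n]}, nilpotent_for L P -> eventually_vanishing L P.

Definition homogeneous (R : realType) (n : nat) (P : {mpoly R[i][n]}) : Prop :=
  exists d : nat, P \is d.-homog.

Definition HVC (R : realType) (n : nat)
    (L : {mpoly R[i][n]} -> {mpoly R[i][n]}) : Prop :=
  forall P : {mpoly R[i][n]},
    homogeneous P -> nilpotent_for L P -> eventually_vanishing L P.

Definition laplacian (R : realType) (n : nat) (P : {mpoly R[i][n]}) :
    {mpoly R[i][n]} :=
  \sum_(i < n) (P^`M(i))^`M(i).

(* An operator sum_{i,j} a_ij D_i D_j in the union D_2 of the nested sets     *)
(* D_2[1], D_2[2], ... is given by its symmetric coefficient family           *)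
(* a : nat -> nat -> R[i]; it lies in D_2[n] when only the first n variables  *)
(* (numbered 0, ..., n-1) occur. Thus the same a can lie in several D_2[n].   *)
Definition D2_in (R : realType) (n : nat) (a : nat -> nat -> R[i]) : Prop :=
  (forall i j : nat, a i j = a j i) /\
  (forall i j : nat, (n <= i)%N -> a i j = 0).

Definition D2 (R : realType) (a : nat -> nat -> R[i]) : Prop :=
  exists2 n : nat, (0 < n)%N & D2_in n a.

(* The action of a on A_n; meaningful when D2_in n a. *)
Definition D2_op (R : realType) (n : nat) (a : nat -> nat -> R[i])
    (P : {mpoly R[i][n]}) : {mpoly R[i][n]} :=
  \sum_(i < n) \sum_(j < n) a i j *: (P^`M(j))^`M(i).

Definition D2_mx (R : realType) (n : nat) (a : nat -> nat -> R[i]) :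
    'M[R[i]]_n :=
  \matrix_(i < n, j < n) a i j.

(* Independent of the witness n, see D2_rank_unique. *)
Definition D2_rank (R : realType) (a : nat -> nat -> R[i]) (r : nat) : Prop :=
  exists2 n : nat, D2_in n a & \rank (D2_mx n a) = r.

Lemma D2_rank_widen (R : realType) (n k : nat) (a : nat -> nat -> R[i]) :
  D2_in n a -> \rank (D2_mx (n + k) a) = \rank (D2_mx n a).
Proof.
move=> [asym a0].
have -> : D2_mx (n + k) a = block_mx (D2_mx n a) 0 0 (0 : 'M_k).
  apply/matrixP=> i j; rewrite !mxE.
  case: (splitP i) => i' ->; rewrite !mxE; case: (splitP j) => j' ->;
    rewrite !mxE //.
  - by rewrite asym a0 ?leq_addr.
  - by rewrite a0 ?leq_addr.
  - by rewrite a0 ?leq_addr.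
by rewrite rank_diag_block_mx mxrank0 addn0.
Qed.

Lemma D2_rank_unique (R : realType) (a : nat -> nat -> R[i]) (r s : nat) :
  D2_rank a r -> D2_rank a s -> r = s.
Proof.
move=> [m am <-] [n an <-].
case/orP: (leq_total m n) => [le_mn | le_nm].
  by rewrite -(subnKC le_mn) D2_rank_widen.
by rewrite -(subnKC le_nm) D2_rank_widen.
Qed.

(* Formal power series in n variables, as families of coefficients. *)
Definition fps (R : realType) (n : nat) : Type := 'X_{1..n} -> R[i].

Definition fps_of_mpoly (R : realType) (n : nat) (p : {mpoly R[i][n]}) :
    fps R n :=
  fun m => p@_m.

Definition fps_trunc (R : realType) (n k : nat) (g : fps R n) :
    {mpoly R[i][n]} :=
  \sum_(m : 'X_{1..n < k}) g m *: 'X_[m].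

(* The composition g(f_1, ..., f_p), for series f_i without constant term:    *)
(* its coefficient at m then only depends on the terms of degree at most      *)
(* mdeg m of g and of the f_i. (Meaningless if some f_i has a constant term.) *)
Definition fps_comp (R : realType) (n p : nat) (g : fps R p)
    (f : 'I_p -> fps R n) : fps R n :=
  fun m => ((fps_trunc (mdeg m).+1 g)
              \mPo [tuple fps_trunc (mdeg m).+1 (f i) | i < p])@_m.

Definition jacobian (R : realType) (n : nat) (F : n.-tuple {mpoly R[i][n]}) :
    {mpoly R[i][n]} :=
  \det (\matrix_(i < n, j < n) (tnth F i)^`M(j)).

(* F(z) - F(0) *)
Definition centered (R : realType) (n : nat) (F : n.-tuple {mpoly R[i][n]})
    (i : 'I_n) : fps R n :=
  fps_of_mpoly (tnth F i - ((tnth F i)@_0)%:MP).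

(* G is the formal inverse of F, expanded at the point F(0):                  *)
(* z = G(F(z) - F(0)) and F(G(w)) - F(0) = w, where G(0) = 0.                 *)
Definition formal_inverse (R : realType) (n : nat)
    (F : n.-tuple {mpoly R[i][n]}) (G : 'I_n -> fps R n) : Prop :=
  [/\ forall i : 'I_n, G i 0%MM = 0,
      forall i : 'I_n, fps_comp (G i) (centered F) =1 fps_of_mpoly 'X_i
    & forall i : 'I_n, fps_comp (centered F i) G =1 fps_of_mpoly 'X_i].

Definition polynomial_map (R : realType) (n : nat) (G : 'I_n -> fps R n) :
    Prop :=
  forall i : 'I_n, exists p : {mpoly R[i][n]}, G i =1 fps_of_mpoly p.

(* When the jacobian is 1 the formal inverse exists and is unique. *)
Definition JC (R : realType) : Prop :=
  forall (n : nat) (F : n.-tuple {mpoly R[i][n]}),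
    (0 < n)%N -> jacobian F = 1 ->
    exists2 G : 'I_n -> fps R n, formal_inverse F G & polynomial_map G.

(* Main.v *)
Require Import Defs.
From HB Require Import structures.
From mathcomp Require Import all_boot all_order all_algebra.
From mathcomp Require Import reals complex mpoly ring zify.

Set Implicit Arguments.
Unset Strict Implicit.
Unset Printing Implicit Defensive.

Import GRing.Theory Num.Theory.
Local Open Scope ring_scope.

(**
A symmetric matrix of rank at least 2n over an algebraically closed field can be
carried by a linear substitution to any symmetric n x n matrix, and such a
substitution is compatible with the corresponding differential operators; this
gives HVC for all quadratic operators.  Homogenizing P with one more variable,
on which the operator does not act, turns HVC into VC.

For the Jacobian conjecture, let H be a polynomial map with det (1 - t JH) = 1
and let G = z + t H(G) be the formal inverse of z - t H.  By Jacobi's formula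
for the derivative of a determinant, H(G) is divergence free, so that
d/dt u(G) = sum_i D_i ((H_i u)(G)) for all polynomials u.  Hence the coefficient
of t^m in u(G) is S_m(u) / m!, where S_m(u) is the sum of the
D_i1 ... D_im (H_i1 ... H_im u).  With P = sum_i w_i H_i(z) and
Lambda = sum_i d/dz_i d/dw_i, one has Lambda^m (P^m) = m! S_m(1) = 0 and
Lambda^m (P^(m+1)) = (m+1)! sum_i w_i S_m(H_i), so VC says that H(G), hence G,
is polynomial in t.  A map F = z + (higher order) with det JF = 1 gives
t^-1 F(t z) = z - t h(z, t) with unimodular Jacobian, and the dependence of h on
t is removed by repeatedly doubling the number of variables.
*)

(** * Polynomial substitutions and derivations *)

Section Evaluation.

Variables (K : comNzRingType) (n : nat).
Implicit Types (u v : {mpoly K[n]}) (p q : {poly {mpoly K[n]}}).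

Lemma mpoly_ring_ind (P : {mpoly K[n]} -> Prop) :
  (forall c, P c%:MP) -> (forall i, P 'X_i) ->
  (forall u v, P u -> P v -> P (u + v)) ->
  (forall u v, P u -> P v -> P (u * v)) -> forall u, P u.
Proof.
move=> PC PX PD PM u; rewrite [u]mpolyE.
apply: (big_ind P) => [||m _]; [by rewrite -mpolyC0; apply: PC|exact: PD|].
rewrite -mul_mpolyC; apply: (PM) => //; rewrite mpolyXE_id.
apply: (big_ind P) => [||i _]; [by rewrite -mpolyC1; apply: PC|exact: PM|].
elim: (m _) => [|k IHk]; first by rewrite expr0 -mpolyC1; apply: PC.
by rewrite exprS; apply: PM.
Qed.

Lemma poly_mpoly_ring_ind (P : {poly {mpoly K[n]}} -> Prop) :
  (forall c, P (c%:MP)%:P) -> (forall i, P ('X_i)%:P) -> P 'X ->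
  (forall p q, P p -> P q -> P (p + q)) ->
  (forall p q, P p -> P q -> P (p * q)) -> forall p, P p.
Proof.
move=> PC PX Pt PD PM p.
have PA u : P u%:P.
  elim/mpoly_ring_ind: u => // u v Pu Pv; first by rewrite polyCD; apply: PD.
  by rewrite polyCM; apply: PM.
by elim/poly_ind: p => [|p u Pp]; [apply: PA | apply/PD/PA/PM].
Qed.

Variable S : comNzRingType.
Implicit Types (c : {rmorphism K -> S}) (h g : 'I_n -> S) (t : S).

(** A single evaluation of polynomials in z and t, through which [bsub] and [at1] are defined;
    identities between substitutions then reduce to constants, variables and t. *)
Definition peval c h t : {poly {mpoly K[n]}} -> S :=
  horner_eval t \o map_poly (mmap c h).

HB.instance Definition _ c h t :=
  GRing.RMorphism.copy (peval c h t) (horner_eval t \o map_poly (mmap c h)).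

Lemma pevalC c h t u : peval c h t u%:P = mmap c h u.
Proof. by rewrite /peval /= map_polyC /= horner_evalE hornerC. Qed.

Lemma pevalX c h t : peval c h t 'X = t.
Proof. by rewrite /peval /= map_polyX horner_evalE hornerX. Qed.

Lemma mmapU c h i : mmap c h 'X_i = h i.
Proof. by rewrite mmapX mmap1U. Qed.

End Evaluation.

Section Morphisms.

Variables (K : comNzRingType) (n : nat) (S : comNzRingType).
Implicit Types (u v : {mpoly K[n]}) (p q : {poly {mpoly K[n]}}).
Implicit Types (c : {rmorphism K -> S}) (h g : 'I_n -> S) (t : S).

Lemma eq_rmorph_poly_mpoly (f f' : {rmorphism {poly {mpoly K[n]}} -> S}) :
  (forall a, f (a%:MP)%:P = f' (a%:MP)%:P) ->
  (forall i, f ('X_i)%:P = f' ('X_i)%:P) -> f 'X = f' 'X -> f =1 f'.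
Proof.
move=> eqC eqU eqX p.
elim/poly_mpoly_ring_ind: p => // p q IHp IHq;
  first by rewrite !rmorphD IHp IHq.
by rewrite !rmorphM IHp IHq.
Qed.

Lemma eq_rmorph_mpoly (f f' : {rmorphism {mpoly K[n]} -> S}) :
  (forall a, f a%:MP = f' a%:MP) -> (forall i, f 'X_i = f' 'X_i) -> f =1 f'.
Proof.
move=> eqC eqU u.
elim/mpoly_ring_ind: u => // u v IHu IHv; first by rewrite !rmorphD IHu IHv.
by rewrite !rmorphM IHu IHv.
Qed.

Lemma pevalU c h t i : peval c h t ('X_i)%:P = h i.
Proof. by rewrite pevalC mmapU. Qed.

Lemma pevalCC c h t a : peval c h t (a%:MP)%:P = c a.
Proof. by rewrite pevalC mmapC. Qed.

Lemma eq_mmap c h g : h =1 g -> mmap c h =1 mmap c g.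
Proof.
by move=> hg u; apply: eq_bigr => m _; congr (_ * _); apply: mmap1_eq.
Qed.

(** Serves both for the multiples of a power of t and for the polynomials of given order at the
    origin. *)
Definition ideal_like (I : S -> Prop) :=
  (forall a b, I a -> I b -> I (a + b)) /\ (forall a b, I b -> I (a * b)).

Lemma ideal_likeN I a : ideal_like I -> I a -> I (- a).
Proof. by case=> _ IM Ia; rewrite -mulN1r; apply: IM. Qed.

Lemma peval_congr I c h g t p : ideal_like I -> I 0 ->
  (forall i, I (h i - g i)) -> I (peval c h t p - peval c g t p).
Proof.
move=> [ID IM] I0 Ihg.
elim/poly_mpoly_ring_ind: p => [a|i||p q IHp IHq|p q IHp IHq].
- by rewrite !pevalC !mmapC subrr.
- by rewrite !pevalC !mmapU.
- by rewrite !pevalX subrr.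
- by rewrite !rmorphD /= opprD addrACA; apply: ID.
- have -> : peval c h t (p * q) - peval c g t (p * q) =
    peval c h t q * (peval c h t p - peval c g t p) +
    peval c g t p * (peval c h t q - peval c g t q).
    rewrite !rmorphM /= !mulrBr [peval c h t q * _]mulrC.
    by rewrite [peval c h t q * _]mulrC addrA subrK.
  by apply: ID; apply: IM.
Qed.

Lemma mmap_congr I c h g u : ideal_like I -> I 0 ->
  (forall i, I (h i - g i)) -> I (mmap c h u - mmap c g u).
Proof. by rewrite -(pevalC c h 0) -(pevalC c g 0); apply: peval_congr. Qed.

Lemma mderivU i k : ('X_i : {mpoly K[n]})^`M(k) = (i == k)%:R.
Proof.
rewrite mderivX mnm1E; case: eqP => [->|_]; last by rewrite scale0r.
suff -> : (U_(k) - U_(k) = 0 :> 'X_{1..n})%MM by rewrite mpolyX0 scale1r.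
by apply/mnmP => j; rewrite mnmBE subnn mnm0E.
Qed.

Definition leibniz (T : pzRingType) (d : T -> T) :=
  forall a b, d (a * b) = d a * b + a * d b.

(** Chain rule for an arbitrary derivation killing the constants: one proof serves d/dt, the d/dz_k
    and substitutions that change the set of variables. *)
Lemma mmap_chain (d : {additive S -> S}) c h u : leibniz d ->
  (forall a, d (c a) = 0) ->
  d (mmap c h u) = \sum_k mmap c h u^`M(k) * d (h k).
Proof.
move=> dM dc; elim/mpoly_ring_ind: u => [a|i|p q IHp IHq|p q IHp IHq].
- by rewrite mmapC dc big1 // => k _; rewrite mderivC mmap0 mul0r.
- rewrite mmapU (bigD1 i) //= big1 => [|k neq_ki].
    by rewrite mderivU eqxx rmorph1 mul1r addr0.
  by rewrite mderivU eq_sym (negPf neq_ki) mmap0 mul0r.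
- rewrite !raddfD /= IHp IHq -big_split; apply: eq_bigr => k _ /=.
  by rewrite mderivD rmorphD mulrDl.
- rewrite rmorphM dM /= IHp IHq mulr_suml mulr_sumr -big_split.
  apply: eq_bigr => k _ /=.
  by rewrite mderivM rmorphD !rmorphM /= mulrDl mulrAC mulrA.
Qed.

End Morphisms.

(** * Fixed points modulo powers of t *)

Section FixedPoint.

Variables (K : comNzRingType) (n : nat).
Local Notation A := {mpoly K[n]}.
Local Notation B := {poly {mpoly K[n]}}.
Implicit Types (p q : B) (f h : 'I_n -> B) (G : 'I_n -> B).

(* Power series in t are represented by polynomials in t := 'X modulo t^M. *)
Definition modX M p := exists r, p = r * 'X^M.

Lemma modX_ideal M : ideal_like (modX M).
Proof.
split=> [_ _ [r ->] [s ->]|a _ [r ->]]; first by exists (r + s); rewrite mulrDl.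
by exists (a * r); rewrite mulrA.
Qed.

Lemma modX0 M : modX M 0.
Proof. by exists 0; rewrite mul0r. Qed.

Lemma modXD M p q : modX M p -> modX M q -> modX M (p + q).
Proof. exact: (modX_ideal M).1. Qed.

Lemma modXM M p q : modX M q -> modX M (p * q).
Proof. exact: (modX_ideal M).2. Qed.

Lemma modXN M p : modX M p -> modX M (- p).
Proof. exact: ideal_likeN (modX_ideal M). Qed.

Lemma modXS M p : modX M p -> modX M.+1 ('X * p).
Proof. by case=> r ->; exists r; rewrite exprS !mulrA -commr_polyX. Qed.

Lemma modX_le M N p : (M <= N)%N -> modX N p -> modX M p.
Proof.
by move=> leMN [r ->]; exists (r * 'X^(N - M)); rewrite -mulrA -exprD subnK.
Qed.

Lemma modX_coef M p m : (m < M)%N -> modX M p -> p`_m = 0.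
Proof. by move=> ltmM [r ->]; rewrite coefMXn ltmM. Qed.

Lemma modX_all p : (forall M, modX M p) -> p = 0.
Proof.
by move=> p0; apply/polyP => m; rewrite coef0; apply: modX_coef (p0 m.+1).
Qed.

Definition bcst : K -> B := polyC \o @mpolyC n K.
HB.instance Definition _ := GRing.RMorphism.copy bcst (polyC \o @mpolyC n K).

Definition bvar (i : 'I_n) : B := ('X_i)%:P.

(* z_i := G_i(z, t), with t left unchanged. *)
Definition bsub G : B -> B := peval bcst G 'X.
HB.instance Definition _ G := GRing.RMorphism.copy (bsub G) (peval bcst G 'X).

Lemma bsub_congr M G G' p :
  (forall i, modX M (G i - G' i)) -> modX M (bsub G p - bsub G' p).
Proof. by move=> GG'; apply: (peval_congr _ _ _ (modX_ideal M) (modX0 M)). Qed.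

(** Picard iteration: because of the factor t, each substitution gains one power of t. *)
Lemma fixpoint_approx f h M :
  exists G, forall i, modX M (G i - (f i + 'X * bsub G (h i))).
Proof.
elim: M => [|M [G IH]].
  by exists f => i; exists (f i - (f i + 'X * bsub f (h i))); rewrite mulr1.
exists (fun i => f i + 'X * bsub G (h i)) => i.
rewrite opprD addrACA subrr add0r -mulrBr; apply/modXS/bsub_congr => j.
exact: IH.
Qed.

(** The same contraction: solutions that agree modulo t^k agree modulo t^(k+1), as long as k < M. *)
Lemma fixpoint_unique f h M G G' :
    (forall i, modX M (G i - (f i + 'X * bsub G (h i)))) ->
    (forall i, modX M (G' i - (f i + 'X * bsub G' (h i)))) ->
  forall i, modX M (G i - G' i).
Proof.
move=> fixG fixG'; suff main k : (k <= M)%N -> forall i, modX k (G i - G' i).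
  exact: main.
elim: k => [|k IH] ltkM i; first by exists (G i - G' i); rewrite mulr1.
have -> : G i - G' i = G i - (f i + 'X * bsub G (h i)) -
    (G' i - (f i + 'X * bsub G' (h i))) +
    'X * (bsub G (h i) - bsub G' (h i)) by ring.
apply: modXD; last by apply/modXS/bsub_congr/IH/ltnW.
by apply: modXD; [|apply: modXN]; apply: modX_le ltkM _.
Qed.

End FixedPoint.

(** * Jacobi's formula for the derivative of a determinant *)

Section Jacobi.

Variables (S : comNzRingType) (d : {additive S -> S}).
Hypothesis dM : leibniz d.

Lemma leibniz1 : d 1 = 0.
Proof.
have /eqP := dM 1 1; rewrite !mulr1 mul1r -subr_eq subrr => /eqP <- //.
Qed.

Lemma leibniz_prod (I : finType) (F : I -> S) :
  d (\prod_i F i) = \sum_i \prod_j (if j == i then d (F j) else F j).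
Proof.
suff main (s : seq I) : uniq s -> d (\prod_(i <- s) F i) =
    \sum_(i <- s) \prod_(j <- s) (if j == i then d (F j) else F j).
  by have := main (index_enum I) (index_enum_uniq I).
elim: s => [|i s IHs] /=; first by rewrite !big_nil leibniz1.
case/andP=> s'i uniq_s; rewrite !big_cons dM IHs // mulr_sumr eqxx;
  congr (_ + _).
  congr (_ * _); rewrite !big_seq; apply: eq_bigr => j sj.
  by case: eqP s'i sj => // -> /negPf ->.
rewrite !big_seq; apply: eq_bigr => j sj; rewrite big_cons.
by case: eqP s'i sj => // -> /negPf ->.
Qed.

(** Multilinearity differentiates one row at a time; expansion along that row leaves the cofactors
    of [U], which do not involve it. *)
Lemma leibniz_det m (U : 'M[S]_m) :
  d (\det U) = \tr (\adj U *m map_mx d U).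
Proof.
pose V i := \matrix_(k, j) if k == i then d (U k j) else U k j.
have -> : d (\det U) = \sum_i \det (V i).
  rewrite /determinant raddf_sum exchange_big /=; apply: eq_bigr => s _.
  rewrite mulr_sign.
  have -> (b : bool) x : d (if b then - x else x) = if b then - d x else d x.
    by case: b; rewrite ?raddfN.
  rewrite leibniz_prod -mulr_sign mulr_sumr; apply: eq_bigr => i _.
  by congr (_ * _); apply: eq_bigr => k _; rewrite mxE.
transitivity (\sum_i \sum_j d (U i j) * cofactor U i j).
  apply: eq_bigr => i _; rewrite (expand_det_row _ i); apply: eq_bigr => j _.
  rewrite mxE eqxx; congr (_ * (_ * \det _)); apply/matrixP => k l.
  by rewrite !mxE eq_sym (negPf (neq_lift _ _)).
rewrite exchange_big /=; apply: eq_bigr => j _; rewrite mxE.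
by apply: eq_bigr => i _; rewrite !mxE mulrC.
Qed.

End Jacobi.

(** * The flow of a map with unimodular Jacobian *)

Section Flow.

Variables (K : comNzRingType) (n : nat).
Local Notation A := {mpoly K[n]}.
Local Notation B := {poly {mpoly K[n]}}.

Definition bderiv (k : 'I_n) : B -> B := map_poly (mderiv k).
HB.instance Definition _ k :=
  GRing.Additive.copy (bderiv k) (map_poly (mderiv k)).

Lemma bderiv_leibniz k : leibniz (bderiv k).
Proof.
move=> p q; apply/polyP => m;
  rewrite coef_map coefD !coefM raddf_sum -big_split.
by apply: eq_bigr => i _ /=; rewrite !coef_map mderivM.
Qed.

Lemma deriv_leibniz : leibniz (@deriv A).
Proof. exact: derivM. Qed.

Lemma bderivC k u : bderiv k u%:P = (u^`M(k))%:P.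
Proof. by rewrite /bderiv map_polyC. Qed.

Lemma bderiv_modX M k p : modX M p -> modX M (bderiv k p).
Proof.
case=> r ->; exists (bderiv k r); apply/polyP => m.
by rewrite coef_map !coefMXn /=; case: ifP; rewrite ?raddf0 ?coef_map.
Qed.

Lemma bderivXM k p : bderiv k ('X * p) = 'X * bderiv k p.
Proof.
apply/polyP => m; rewrite coef_map !coefXM.
by case: ifP; rewrite ?raddf0 ?coef_map.
Qed.

Lemma deriv_modX M (p : B) : modX M p -> modX M.-1 p^`().
Proof.
case=> r ->; rewrite derivM derivXn; case: M => [|M].
  by eexists; rewrite [RHS]mulr1.
by exists (r^`() * 'X + r *+ M.+1); rewrite mulrDl mulrnAr mulrnAl exprS mulrA.
Qed.

Variables (H : 'I_n -> A) (M : nat) (G : 'I_n -> B).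

Definition mxjac : 'M[A]_n := \matrix_(i, j) (H i)^`M(j).
Local Notation J := (map_mx polyC mxjac).
Local Notation U := (1%:M - 'X *: J : 'M[B]_n).

Hypothesis det1 : \det U = 1.
Hypothesis fixG : forall i, modX M (G i - (bvar K i + 'X * bsub G (H i)%:P)).

Local Notation phi u := (bsub G u%:P).

Lemma phi_chain (d : {additive B -> B}) u : leibniz d ->
  (forall a : K, d (a%:MP)%:P = 0) -> d (phi u) = \sum_k phi u^`M(k) * d (G k).
Proof.
move=> dM dc; rewrite /bsub pevalC mmap_chain //.
by apply: eq_bigr => k _; rewrite pevalC.
Qed.

Lemma bderiv_phi k u : bderiv k (phi u) = \sum_l phi u^`M(l) * bderiv k (G l).
Proof.
apply: phi_chain => [|a]; first exact: bderiv_leibniz.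
by rewrite /= bderivC mderivC.
Qed.

Lemma deriv_phi u : (phi u)^`() = \sum_l phi u^`M(l) * (G l)^`().
Proof. by apply: (@phi_chain (@deriv A) u deriv_leibniz) => a;
  apply: derivC. Qed.

Definition mxmodX m a b (X : 'M[B]_(a, b)) := forall i j, modX m (X i j).

Lemma mxmodXM m a b c (X : 'M[B]_(a, b)) (Y : 'M[B]_(b, c)) :
  mxmodX m Y -> mxmodX m (X *m Y).
Proof.
move=> Y0 i j; rewrite mxE; apply: (big_ind (modX m)) => [||k _].
- exact: modX0.
- exact: modXD.
- exact: modXM.
Qed.

Lemma mxmodXMr m a b c (X : 'M[B]_(a, b)) (Y : 'M[B]_(b, c)) :
  mxmodX m X -> mxmodX m (X *m Y).
Proof.
move=> X0; rewrite -[_ *m _]trmxK trmx_mul => i j; rewrite mxE.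
by apply: mxmodXM => k l; rewrite mxE.
Qed.

Lemma mxmodXD m a b (X Y : 'M[B]_(a, b)) :
  mxmodX m X -> mxmodX m Y -> mxmodX m (X + Y).
Proof. by move=> X0 Y0 i j; rewrite mxE; apply: modXD. Qed.

Lemma mxmodX_inv m b (X Y : 'M[B]_n) (Z W : 'M[B]_(n, b)) :
  X *m Y = 1%:M -> mxmodX m (Y *m Z - W) -> mxmodX m (Z - X *m W).
Proof.
move=> XY YZW; suff -> : Z - X *m W = X *m (Y *m Z - W) by apply: mxmodXM.
by rewrite mulmxBr mulmxA XY mul1mx.
Qed.

Let JG : 'M[B]_n := \matrix_(i, j) bderiv j (G i).
Let dG : 'cV[B]_n := \col_i (G i)^`().
Let HG : 'cV[B]_n := \col_i phi (H i).
Let phiJ := map_mx (bsub G) J.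
Let phiU := map_mx (bsub G) U.
Let phiA := map_mx (bsub G) (\adj U).

Let phiUE : phiU = 1%:M - 'X *: phiJ.
Proof.
rewrite /phiU map_mxB map_mx1 map_mxZ.
by congr (_ - _ *: _); apply: pevalX.
Qed.

(** With determinant 1 the adjugate inverts [U] exactly, not only modulo a power of t. *)
Let phiAU : phiA *m phiU = 1%:M.
Proof. by rewrite -map_mxM mul_adj_mx det1 map_scalar_mx rmorph1. Qed.

(** Differentiating the fixed-point equation in z keeps the power of t. *)
Let JG_mod : mxmodX M (phiU *m JG - 1%:M).
Proof.
move=> i j; have := bderiv_modX j (fixG i).
rewrite phiUE mulmxBl mul1mx -scalemxAl !mxE.
rewrite raddfB raddfD /= bderivXM bderiv_phi [bderiv j (bvar _ _)]bderivC.
rewrite mderivU polyC_natr opprD addrA addrAC.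
by congr (modX _ (_ - 'X * _ - _)); apply: eq_bigr => k _; rewrite !mxE.
Qed.

(** Differentiating the fixed-point equation in t costs one power of t, hence [M.-1]. *)
Let dG_mod : mxmodX M.-1 (phiU *m dG - HG).
Proof.
move=> i j; have := deriv_modX (fixG i).
rewrite phiUE mulmxBl mul1mx -scalemxAl !mxE.
rewrite derivB derivD derivM derivX mul1r [(bvar _ _)^`()]derivC add0r.
rewrite deriv_phi opprD addrA addrAC.
by congr (modX _ (_ - 'X * _ - _)); apply: eq_bigr => k _; rewrite !mxE.
Qed.

Let JG_adj : mxmodX M (JG - phiA).
Proof. by rewrite -[phiA]mulmx1; apply: mxmodX_inv phiAU JG_mod. Qed.

(** Both [JG] and [phiA] invert I - t JH(G) modulo t^M, so the solution (I - t JH(G))^-1 H(G) for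
    dG/dt becomes JG H(G). *)
Let dG_JG : mxmodX M.-1 (dG - JG *m HG).
Proof.
have := mxmodX_inv phiAU dG_mod; have := JG_adj.
move: JG dG HG phiA => X Y Z W XW YWZ.
have -> : Y - X *m Z = (Y - W *m Z) + - (X - W) *m Z.
  by rewrite mulNmx mulmxBl opprB addrA subrK.
apply: mxmodXD => //; rewrite mulNmx => i j; rewrite mxE; apply: modXN.
by apply: modX_le (leq_pred M) _; apply: mxmodXMr.
Qed.

(** The divergence is the trace of JH(G) JG. Modulo t^M, JG is the adjugate of [U] evaluated at G,
    and tr(J adj U) = - d/dt det U = 0. *)
Let div_phi : modX M (\sum_i bderiv i (phi (H i))).
Proof.
have -> : \sum_i bderiv i (phi (H i)) = \tr (phiJ *m JG).
  apply: eq_bigr => i _; rewrite mxE bderiv_phi.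
  by apply: eq_bigr => k _; rewrite !mxE.
have tr0 : \tr (phiJ *m phiA) = 0.
  rewrite -map_mxM trace_map_mx mxtrace_mulC.
  have := leibniz_det deriv_leibniz U; rewrite det1 /= derivC.
  have -> : map_mx deriv U = - J.
    apply/matrixP => i j; rewrite !mxE derivB -polyC_natr derivC derivM derivX.
    by rewrite derivC mulr0 addr0 mul1r sub0r.
  by rewrite mulmxN raddfN => /eqP; rewrite eq_sym oppr_eq0 => /eqP ->;
    rewrite rmorph0.
have -> : \tr (phiJ *m JG) = \tr (phiJ *m (JG - phiA)).
  by rewrite mulmxBr raddfB /= tr0 subr0.
apply: (big_ind (modX M)) => [||k _].
- exact: modX0.
- exact: modXD.
- exact: mxmodXM.
Qed.

(* d/dt u(G) = <(grad u)(G), dG/dt> = <grad(u(G)), H(G)>, and the divergence of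
   H(G) vanishes because det U = 1. *)
Lemma phi_evolution u :
  modX M.-1 ((phi u)^`() - \sum_i bderiv i (phi (H i * u))).
Proof.
pose gu : 'rV[B]_n := \row_k phi u^`M(k).
have -> : (phi u)^`() - \sum_i bderiv i (phi (H i * u)) =
    (gu *m (dG - JG *m HG)) 0 0 - phi u * \sum_i bderiv i (phi (H i)).
  rewrite mulmxBr mulmxA !mxE -addrA -opprD; congr (_ - _).
    by rewrite deriv_phi; apply: eq_bigr => k _; rewrite !mxE.
  rewrite mulr_sumr -big_split; apply: eq_bigr => i _ /=.
  rewrite polyCM rmorphM /= bderiv_leibniz addrC mulrC; congr (_ + _).
    rewrite mulrC !mxE bderiv_phi; congr (_ * _).
    by apply: eq_bigr => k _; rewrite !mxE.
apply: modXD; first by apply: mxmodXM.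
by apply/modXN/modXM; apply: modX_le (leq_pred M) _.
Qed.

Lemma bsub_bvar u : bsub (@bvar K n) u%:P = u%:P.
Proof.
apply: (eq_rmorph_mpoly (f := bsub (@bvar K n) \o polyC) (f' := polyC)) =>
  [a|i] /=.
  by rewrite /bsub pevalCC.
by rewrite /bsub pevalU.
Qed.


(* The sum of D_i1 ... D_im (H_i1 ... H_im u) over all i1, ..., im. *)
Fixpoint div_iter m u : A :=
  if m is m'.+1 then \sum_i (div_iter m' (H i * u))^`M(i) else u.

(** Comparing coefficients in the evolution equation gives (m+1) [t^(m+1)] u(G) = sum_i D_i [t^m]
    (H_i u)(G); the induction starts from G = z modulo t. *)
Lemma phi_coef m u : (m < M)%N -> (phi u)`_m *+ m`! = div_iter m u.
Proof.
elim: m u => [|m IH] u ltmM /=.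
  rewrite mulr1n; have : modX 1 (phi u - bsub (@bvar K n) u%:P).
    apply: bsub_congr => i; have -> : G i - bvar K i =
      (G i - (bvar K i + 'X * phi (H i))) + 'X * phi (H i) by ring.
    apply: modXD; first exact: modX_le (fixG i).
    by exists (phi (H i)); rewrite mulrC.
  move/(modX_coef (ltnSn 0)); rewrite coefB => /subr0_eq ->.
  by rewrite bsub_bvar coefC.
have /(modX_coef (_ : m < M.-1)%N) := phi_evolution u.
rewrite coefB coef_deriv coef_sum => /(_ _)/subr0_eq.
move=> E; rewrite factS mulrnA E;
  last by rewrite -ltnS prednK // (leq_trans _ ltmM).
rewrite -sumrMnl; apply: eq_bigr => i _.
by rewrite coef_map -raddfMn /= IH // ltnW.
Qed.

End Flow.

(** * The vanishing conjecture on the cotangent space *)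

Section Doubling.

Variables (K : comNzRingType) (n : nat) (H : 'I_n -> {mpoly K[n]}).
Local Notation A := {mpoly K[n]}.
Local Notation A2 := {mpoly K[n + n]}.

Definition linj : A -> A2 := mmap (@mpolyC (n + n) K) (fun i => 'X_(lshift n
  i)).
HB.instance Definition _ :=
  GRing.RMorphism.copy linj (mmap (@mpolyC (n + n) K) (fun i => 'X_(lshift n
    i))).

Lemma linjC a : linj a%:MP = a%:MP.
Proof. exact: mmapC. Qed.

Lemma linjU i : linj 'X_i = 'X_(lshift n i).
Proof. exact: mmapU. Qed.

Lemma mderiv_leibniz N (k : 'I_N) : leibniz (@mderiv N K k).
Proof. by move=> p q; rewrite mderivM. Qed.

Lemma mderiv_linj k u : (linj u)^`M(k) =
  \sum_i linj u^`M(i) * (lshift n i == k)%:R.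
Proof.
rewrite /linj (@mmap_chain _ _ _ (mderiv k)) => [||a].
- by apply: eq_bigr => i _; rewrite /= mderivU.
- exact: mderiv_leibniz.
- exact: mderivC.
Qed.

Lemma mderiv_linj_l j u : (linj u)^`M(lshift n j) = linj u^`M(j).
Proof.
rewrite mderiv_linj (bigD1 j) //= eqxx mulr1 big1 ?addr0 // => i neq_ij.
by rewrite eq_lshift (negPf neq_ij) mulr0.
Qed.

Lemma mderiv_linj_r j u : (linj u)^`M(rshift n j) = 0.
Proof. by rewrite mderiv_linj big1 // => i _; rewrite eq_lrshift mulr0. Qed.

Definition hyperbolic_lap (Q : A2) : A2 :=
  \sum_(i < n) (Q^`M(rshift n i))^`M(lshift n i).

Lemma hyperbolic_lap_additive : additive hyperbolic_lap.
Proof.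
move=> p q; rewrite /hyperbolic_lap -sumrB.
by apply: eq_bigr => i _; rewrite !raddfB.
Qed.

HB.instance Definition _ :=
  GRing.isAdditive.Build A2 A2 hyperbolic_lap hyperbolic_lap_additive.

(* sum_i w_i H_i(z), the left variables being z and the right ones w. *)
Definition cotangent_poly : A2 := \sum_(i < n) 'X_(rshift n i) * linj (H i).
Local Notation P := cotangent_poly.

(** The operation of [div_iter] on polynomials in z and w: only z is differentiated, so the w_l
    behave as constants. *)
Fixpoint div_iter2 m (Q : A2) : A2 :=
  if m is m'.+1 then \sum_i (div_iter2 m' (linj (H i) * Q))^`M(lshift n i)
  else Q.

Lemma mderiv_rshift_cotangent i : P^`M(rshift n i) = linj (H i).
Proof.
rewrite /P raddf_sum (bigD1 i) //= big1 => [|j neq_ji].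
  by rewrite mderivM mderivU eqxx mderiv_linj_r mul1r mulr0 !addr0.
by rewrite mderivM mderivU eq_rshift (negPf neq_ji) mderiv_linj_r mul0r mulr0
  addr0.
Qed.

Lemma mderivXn N (p : {mpoly K[N]}) k m :
  (p ^+ m.+1)^`M(k) = p ^+ m * p^`M(k) *+ m.+1.
Proof.
elim: m => [|m IH]; first by rewrite expr1 mul1r.
by rewrite exprS mderivM IH mulrnAr mulrA -exprS mulrC -mulrS.
Qed.

Lemma iter_hyperbolic_lapD m :
  {morph iter m hyperbolic_lap : x y / x + y}.
Proof. by elim: m => // m IH x y; rewrite /= IH raddfD. Qed.

Lemma iter_hyperbolic_lap0 m : iter m hyperbolic_lap 0 = 0.
Proof. by elim: m => //= m ->; rewrite raddf0. Qed.

Lemma iter_hyperbolic_lapMn m k Q :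
  iter m hyperbolic_lap (Q *+ k) = iter m hyperbolic_lap Q *+ k.
Proof. by elim: m => //= m ->; rewrite raddfMn. Qed.

Lemma hyperbolic_lap_comm m k Q :
  iter m hyperbolic_lap Q^`M(k) = (iter m hyperbolic_lap Q)^`M(k).
Proof.
elim: m => //= m ->; move: (iter _ _ _) => X.
rewrite /hyperbolic_lap raddf_sum; apply: eq_bigr => i _ /=.
by rewrite [in LHS](mderiv_comm k) mderiv_comm.
Qed.

(** In each application of Lambda, d/dw_i turns one factor P into H_i and produces the exponent as a
    factor; the outer d/dz_i commutes with the remaining powers of Lambda. Factorials on both sides
    avoid division. *)
Lemma iter_hyperbolic_cotangent m k v :
  iter m hyperbolic_lap (P ^+ (k + m) * linj v) *+ k`! =
  div_iter2 m (P ^+ k * linj v) *+ (k + m)`!.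
Proof.
elim: m v => [|m IH] v; first by rewrite addn0.
have IHv i := congr1 (mderiv (lshift n i)) (IH (H i * v)).
rewrite iterSr addnS {2}/hyperbolic_lap (big_morph _ (iter_hyperbolic_lapD m)
  (iter_hyperbolic_lap0 m)) /= -!sumrMnl; apply: eq_bigr => i _.
rewrite hyperbolic_lap_comm mderivM mderiv_linj_r mulr0 addr0 mderivXn.
rewrite mderiv_rshift_cotangent mulrnAl iter_hyperbolic_lapMn -mulrA.
have := IHv i; rewrite !raddfMn /= (rmorphM linj) => E.
by rewrite mulrnAC E [in RHS]mulrCA -mulrnA mulnC.
Qed.

Lemma div_iter2_linj m v : div_iter2 m (linj v) = linj (div_iter H m v).
Proof.
elim: m v => //= m IH v; rewrite rmorph_sum; apply: eq_bigr => i _.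
by rewrite -rmorphM IH mderiv_linj_l.
Qed.

Lemma div_iter2D m : {morph div_iter2 m : x y / x + y}.
Proof.
elim: m => // m IH x y; rewrite /= -big_split; apply: eq_bigr => i _ /=.
by rewrite mulrDr IH raddfD.
Qed.

Lemma div_iter20 m : div_iter2 m 0 = 0.
Proof. by elim: m => //= m IH; rewrite big1 // => i _;
  rewrite mulr0 IH raddf0. Qed.

Lemma div_iter2_fiber m l Q :
  div_iter2 m ('X_(rshift n l) * Q) = 'X_(rshift n l) * div_iter2 m Q.
Proof.
elim: m Q => //= m IH Q; rewrite mulr_sumr; apply: eq_bigr => i _.
by rewrite mulrCA IH mderivM mderivU eq_rlshift mul0r add0r.
Qed.

Lemma iter_hyperbolic_cotangent0 m :
  iter m hyperbolic_lap (P ^+ m) = linj (div_iter H m 1) *+ m`!.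
Proof.
have := iter_hyperbolic_cotangent m 0 1.
by rewrite add0n rmorph1 !mulr1 mulr1n expr0 -(rmorph1 linj) div_iter2_linj.
Qed.

(** The case k = 1: P is linear in the w_l, which pass through [div_iter2]. *)
Lemma iter_hyperbolic_cotangent1 m :
  iter m hyperbolic_lap (P ^+ m.+1) =
  \sum_l ('X_(rshift n l) * linj (div_iter H m (H l))) *+ m.+1`!.
Proof.
have := iter_hyperbolic_cotangent m 1 1.
rewrite add1n rmorph1 !mulr1 mulr1n expr1 => ->.
rewrite (big_morph _ (div_iter2D m) (div_iter20 m)) -sumrMnl.
by apply: eq_bigr => l _; rewrite div_iter2_fiber div_iter2_linj.
Qed.

Definition lproj : A2 -> A := mmap (@mpolyC n K)
  (fun k => if split k is inl i then 'X_i else 0).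

Lemma linjK : cancel linj lproj.
Proof.
apply: (eq_rmorph_mpoly (f := mmap (@mpolyC n K)
  (fun k => if split k is inl i then 'X_i else 0) \o linj) (f' := idfun)) =>
    [a|i] /=.
  by rewrite linjC mmapC.
by rewrite linjU mmapU -[lshift n i]/(unsplit (inl i)) unsplitK.
Qed.

End Doubling.

(** * Lowering the degree in t *)

Lemma modX_coefP (K : comNzRingType) n M (p : {poly {mpoly K[n]}}) :
  (forall m, (m < M)%N -> p`_m = 0) -> modX M p.
Proof.
move=> p0; exists (drop_poly M p); rewrite -[LHS](poly_take_drop M).
suff -> : take_poly M p = 0 by rewrite add0r.
by apply/polyP => m; rewrite coef_take_poly coef0; case: ifP => // /p0.
Qed.

(** S_m(1) is m! times the coefficient of t^m in 1(G) = 1. *)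
Lemma div_iter_unimodular (K : comNzRingType) n (H : 'I_n -> {mpoly K[n]}) m :
  \det (1%:M - 'X *: map_mx polyC (mxjac H)) = 1 -> (0 < m)%N ->
  div_iter H m 1 = 0.
Proof.
move=> det1 m_gt0.
have [G fixG] := fixpoint_approx (@bvar K n) (fun i => (H i)%:P) m.+1.
rewrite -(phi_coef det1 fixG) // rmorph1 coef1.
by rewrite eqn0Ngt m_gt0 mul0rn.
Qed.

Lemma linear_flow_inverse (K : numFieldType) n (H : 'I_n -> {mpoly K[n]}) N :
  \det (1%:M - 'X *: map_mx polyC (mxjac H)) = 1 ->
  (forall m i, (N <= m)%N -> div_iter H m (H i) = 0) ->
  exists G, forall i, G i = bvar K i + 'X * bsub G (H i)%:P.
Proof.
move=> det1 H0.
(* H_i(G) must have the coefficients S_m(H_i) / m!, which vanish from m = N on. The candidate is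
   compared with approximate solutions modulo every t^M. *)
pose G i := bvar K i + 'X * \poly_(m < N) ((m`!%:R)^-1 *: div_iter H m (H i)).
exists G => i; apply/subr0_eq/modX_all => M.
have [G' fixG'] := fixpoint_approx (@bvar K n) (fun i => (H i)%:P) M.
have GG' j : modX M (G j - G' j).
  have -> : G j - G' j = 'X * (\poly_(m < N) ((m`!%:R)^-1 *: div_iter H m (H j))
     - bsub G' (H j)%:P) - (G' j - (bvar K j + 'X * bsub G' (H j)%:P)).
    by rewrite /G; ring.
  apply: modXD; last exact/modXN.
  apply/modXM/modX_coefP => m ltmM; rewrite coefB coef_poly.
  have fact_neq0 : (m`!%:R : K) != 0 by rewrite pnatr_eq0 -lt0n fact_gt0.
  have <- : (bsub G' (H j)%:P)`_m = (m`!%:R)^-1 *: div_iter H m (H j).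
    rewrite -(phi_coef det1 fixG' _ ltmM) -scaler_nat scalerA mulVf //.
    by rewrite scale1r.
  case: ltnP => [_|leNm]; first by rewrite subrr.
  have := phi_coef det1 fixG' (H j) ltmM; rewrite H0 // -scaler_nat => /eqP.
  by rewrite scaler_eq0 (negPf fact_neq0) => /eqP ->; rewrite subrr.
have -> : G i - (bvar K i + 'X * bsub G (H i)%:P) = (G i - G' i) +
    (G' i - (bvar K i + 'X * bsub G' (H i)%:P)) +
    'X * (bsub G' (H i)%:P - bsub G (H i)%:P) by ring.
apply: modXD; first exact: modXD.
by apply: modXM; rewrite -opprB; apply/modXN/bsub_congr.
Qed.

Section Stabilization.

Variables (K : comNzRingType) (n : nat).
Local Notation B := {poly {mpoly K[n]}}.
Local Notation B2 := {poly {mpoly K[n + n]}}.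

Definition binj : B -> B2 := map_poly (@linj K n).
HB.instance Definition _ := GRing.RMorphism.copy binj (map_poly (@linj K n)).

Lemma binjC u : binj u%:P = (linj u)%:P.
Proof. exact: map_polyC. Qed.

Lemma binjX : binj 'X = 'X.
Proof. exact: map_polyX. Qed.

Lemma bderiv_binj_l j p : bderiv (lshift n j) (binj p) = binj (bderiv j p).
Proof. by apply/polyP => m; rewrite !coef_map /= mderiv_linj_l. Qed.

Lemma bderiv_binj_r j p : bderiv (rshift n j) (binj p) = 0.
Proof. by apply/polyP => m; rewrite coef0 !coef_map /= mderiv_linj_r. Qed.

Variable h : 'I_n -> B.

(* Splitting h = h_0(z) + t k(z, t), the map z - t h(z, t) is replaced by
   (z, y) |-> (z - t (h_0(z) + y), y - t k(z, t)), of lower degree in t. *)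
Definition stab (k : 'I_(n + n)) : B2 :=
  match split k with
  | inl i => binj ((h i)`_0)%:P + bvar K (rshift n i)
  | inr i => binj (drop_poly 1 (h i))
  end.

Lemma stab_l i : stab (lshift n i) = binj ((h i)`_0)%:P + bvar K (rshift n i).
Proof. by rewrite /stab -[lshift n i]/(unsplit (inl i)) unsplitK. Qed.

Lemma stab_r i : stab (rshift n i) = binj (drop_poly 1 (h i)).
Proof. by rewrite /stab -[rshift n i]/(unsplit (inr i)) unsplitK. Qed.

Lemma drop1E i : h i = ((h i)`_0)%:P + 'X * drop_poly 1 (h i).
Proof.
rewrite -[LHS](poly_take_drop 1) mulrC expr1; congr (_ + _).
by apply/polyP => m; rewrite coef_take_poly coefC; case: m.
Qed.

Lemma size_stab e k : (forall i, size (h i) <= e.+2)%N -> (size (stab k) <=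
  e.+1)%N.
Proof.
move=> size_h; rewrite /stab; case: split => i.
  apply: leq_trans (size_polyD _ _) _; rewrite geq_max.
  have sC (u : {mpoly K[n + n]}) : (size u%:P <= e.+1)%N.
    exact: leq_trans (size_polyC_leq1 _) _.
  by rewrite binjC; apply/andP; split; apply: sC.
apply: leq_trans (size_poly _ _) _; rewrite size_drop_poly.
by rewrite leq_subLR; apply: size_h.
Qed.

Lemma det_stab :
  \det (1%:M - 'X *: \matrix_(i, j) bderiv j (h i)) = 1 ->
  \det (1%:M - 'X *: \matrix_(i, j) bderiv j (stab i)) = 1.
Proof.
move=> det_h.
pose J0 := \matrix_(i < n, j < n) bderiv j ((h i)`_0)%:P.
pose J1 := \matrix_(i < n, j < n) bderiv j (drop_poly 1 (h i)).
have -> : 1%:M - 'X *: (\matrix_(i, j) bderiv j (stab i)) =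
    block_mx (1%:M - 'X *: map_mx binj J0) (- 'X)%:M
             (- ('X *: map_mx binj J1)) 1%:M.
  apply/matrixP => i j; case: (split_ordP i) => {}i ->;
    case: (split_ordP j) => {}j ->.
  - rewrite block_mxEul !mxE stab_l raddfD /= bderiv_binj_l [bderiv _ (bvar _
    _)]bderivC mderivU.
    by rewrite eq_lshift eq_rlshift addr0.
  - rewrite block_mxEur !mxE stab_l raddfD /= bderiv_binj_r [bderiv _ (bvar _
    _)]bderivC mderivU.
    by rewrite eq_lrshift eq_rshift mulr0n !add0r polyC_natr mulr_natr mulNrn.
  - rewrite block_mxEdl !mxE stab_r bderiv_binj_l.
    by rewrite eq_rlshift mulr0n sub0r.
  - rewrite block_mxEdr !mxE stab_r bderiv_binj_r.
    by rewrite eq_rshift mulr0 subr0.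
(* Right multiplication by this unitriangular matrix clears the lower left block and turns the upper
   left one into I - t J0 - t^2 J1 = I - t Jh. *)
have detL : \det (block_mx 1%:M 0 ('X *: map_mx binj J1) (1%:M : 'M_n)) = 1.
  by rewrite det_lblock !det1 mulr1.
rewrite -[LHS]mulr1 -[X in _ * X]detL -det_mulmx.
rewrite mulmx_block !mulmx1 !mulmx0 !add0r mul1mx addNr.
rewrite det_ublock det1 mulr1 mul_scalar_mx scalerA.
suff -> : 1%:M - 'X *: map_mx binj J0 + (- 'X * 'X) *: map_mx binj J1 =
   map_mx binj (1%:M - 'X *: \matrix_(i, j) bderiv j (h i)).
  by rewrite det_map_mx det_h rmorph1.
apply/matrixP => i j; rewrite !mxE.
have -> : bderiv j (h i) =
    bderiv j ((h i)`_0)%:P + 'X * bderiv j (drop_poly 1 (h i)).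
  by rewrite {1}[h i]drop1E raddfD /= bderivXM.
rewrite rmorphB rmorphM rmorphD rmorphM /= rmorph_nat binjX.
by ring.
Qed.

End Stabilization.

(** On the slice y = 0, imposed by [rho], the second half of the solution equals t k(G, t); added to
    h_0(G) it gives h(G, t). *)
Lemma stab_fixpoint (K : comNzRingType) n (h : 'I_n -> {poly {mpoly K[n]}}) G' :
  (forall k, G' k = bvar K k + 'X * bsub G' (stab h k)) ->
  exists G, forall i, G i = bvar K i + 'X * bsub G (h i).
Proof.
move=> fixG'; pose y0 (k : 'I_(n + n)) := if split k is inl i then bvar K i
  else 0.
have [rho [rhoX rhoU rhoC]] :
    exists rho : {rmorphism {poly {mpoly K[n + n]}} -> {poly {mpoly K[n]}}},
    [/\ rho 'X = 'X, forall k, rho (bvar K k) = y0 k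
       & forall a, rho (a%:MP)%:P = (a%:MP)%:P].
  exists (peval (n := n + n) (@bcst K n) y0 'X); split => [|k|a].
  - exact: pevalX.
  - exact: pevalU.
  - exact: pevalCC.
pose G i := rho (G' (lshift n i)); exists G => i.
have rho_l j : rho (bvar K (lshift n j)) = bvar K j.
  by rewrite rhoU /y0 -[lshift n j]/(unsplit (inl j)) unsplitK.
have rho_r j : rho (bvar K (rshift n j)) = 0.
  by rewrite rhoU /y0 -[rshift n j]/(unsplit (inr j)) unsplitK.
have rho_binj p : rho (bsub G' (binj p)) = bsub G p.
  apply: (eq_rmorph_poly_mpoly (f := rho \o bsub G' \o @binj K n)
    (f' := bsub G)) => [a|j|] /=.
  - by rewrite binjC linjC /bsub !pevalCC rhoC.
  - by rewrite binjC linjU /bsub !pevalU.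
  - by rewrite binjX /bsub !pevalX rhoX.
have Gr : rho (G' (rshift n i)) = 'X * bsub G (drop_poly 1 (h i)).
  by rewrite fixG' stab_r rmorphD rmorphM /= rho_r rhoX rho_binj add0r.
have -> : bsub G (h i) = bsub G ((h i)`_0)%:P + rho (G' (rshift n i)).
  by rewrite {1}[h i]drop1E rmorphD rmorphM /= Gr {2}/bsub pevalX.
have -> : G i = rho (bvar K (lshift n i) + 'X * (bsub G' (binj ((h i)`_0)%:P) +
    bsub G' (bvar K (rshift n i)))) by rewrite /G fixG' stab_l [bsub G' (_ +
      _)]rmorphD.
have rhoE a b c : rho (a + 'X * (b + c)) = rho a + 'X * (rho b + rho c).
  by rewrite (rmorphD rho a) (rmorphM rho 'X) (rmorphD rho b) rhoX.
rewrite rhoE; congr (_ + 'X * (_ + rho _)); last exact: pevalU.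
  exact: rho_l.
exact: rho_binj.
Qed.

(** Induction on a bound for the degree of h in t: [stab] lowers the bound by one in 2n variables,
    which is why the hypothesis ranges over all n. In degree 0 the map is z - t H(z). *)
Theorem flow_inverse (K : numFieldType) :
  (forall n (H : 'I_n -> {mpoly K[n]}),
     (forall m, (0 < m)%N -> div_iter H m 1 = 0) ->
     exists N, forall m i, (N <= m)%N -> div_iter H m (H i) = 0) ->
  forall n (h : 'I_n -> {poly {mpoly K[n]}}),
  \det (1%:M - 'X *: \matrix_(i, j) bderiv j (h i)) = 1 ->
  exists G, forall i, G i = bvar K i + 'X * bsub G (h i).
Proof.
move=> vanish n h; have [e] : exists e, forall i, (size (h i) <= e.+1)%N.
  exists (\max_i size (h i))%N => i; apply/leqW/leq_bigmax.
elim: e n h => [|e IH] n h size_h det_h; last first.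
  have [i|] := IH _ (stab h) _ (det_stab det_h); first exact: size_stab.
  by move=> G' /stab_fixpoint.
pose H i := (h i)`_0.
have hE i : h i = (H i)%:P by rewrite [LHS](size1_polyC (size_h i)).
have det_H : \det (1%:M - 'X *: map_mx polyC (mxjac H)) = 1.
  rewrite -[RHS]det_h; congr (\det (_ - _ *: _)); apply/matrixP => i j.
  by rewrite !mxE hE bderivC.
have [m m_gt0|N H0] := vanish n H; first exact: div_iter_unimodular.
have [G fixG] := linear_flow_inverse det_H H0.
by exists G => i; rewrite fixG hE.
Qed.

(** * Linear changes of variables *)

Section LinearSubstitution.

Variable K : comNzRingType.

Definition quad_op n (M : 'M[K]_n) (P : {mpoly K[n]}) : {mpoly K[n]} :=
  \sum_(i < n) \sum_(j < n) M i j *: (P^`M(j))^`M(i).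

Definition lsub n N (B : 'M[K]_(n, N)) : {mpoly K[n]} -> {mpoly K[N]} :=
  mmap (@mpolyC N K) (fun i => \sum_k B i k *: 'X_k).
HB.instance Definition _ n N (B : 'M[K]_(n, N)) :=
  GRing.RMorphism.copy (lsub B)
    (mmap (@mpolyC N K) (fun i => \sum_k B i k *: 'X_k)).

Lemma lsubC n N (B : 'M[K]_(n, N)) a : lsub B a%:MP = a%:MP.
Proof. exact: mmapC. Qed.

Lemma lsubU n N (B : 'M[K]_(n, N)) i : lsub B 'X_i = \sum_k B i k *: 'X_k.
Proof. exact: mmapU. Qed.

Lemma lsubZ n N (B : 'M[K]_(n, N)) a u : lsub B (a *: u) = a *: lsub B u.
Proof. by rewrite -!mul_mpolyC (rmorphM (lsub B)) /= lsubC. Qed.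

Lemma lsub1 n : @lsub n n 1%:M =1 id.
Proof.
apply: (eq_rmorph_mpoly (f := lsub 1%:M) (f' := idfun)) => [a|i].
  exact: lsubC.
rewrite /= lsubU (bigD1 i) //= mxE eqxx scale1r big1 ?addr0 // => k neq_ki.
by rewrite mxE eq_sym (negPf neq_ki) scale0r.
Qed.

Lemma lsub_comp n N m (B : 'M[K]_(n, N)) (C : 'M[K]_(N, m)) u :
  lsub C (lsub B u) = lsub (B *m C) u.
Proof.
apply: (eq_rmorph_mpoly (f := lsub C \o lsub B) (f' := lsub (B *m C))) => [a|i]
  /=.
  by rewrite !lsubC.
rewrite !lsubU rmorph_sum /=.
under eq_bigr => k _ do rewrite lsubZ lsubU scaler_sumr.
rewrite exchange_big; apply: eq_bigr => k _ /=.
by rewrite mxE scaler_suml; apply: eq_bigr => l _; rewrite scalerA.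
Qed.

Lemma mderiv_lsub n N (B : 'M[K]_(n, N)) u k :
  (lsub B u)^`M(k) = \sum_i B i k *: lsub B u^`M(i).
Proof.
rewrite /lsub (@mmap_chain _ _ _ (mderiv k)) => [||a].
- apply: eq_bigr => i _; rewrite -mul_mpolyC mulrC; congr (_ * _).
  rewrite raddf_sum (bigD1 k) //= big1 => [|l neq_lk].
    by rewrite mderivZ mderivU eqxx addr0 -mul_mpolyC mulr1.
  by rewrite mderivZ mderivU (negPf neq_lk) scaler0.
- exact: mderiv_leibniz.
- exact: mderivC.
Qed.

(** By the chain rule D_k becomes sum_i B_ik D_i, so the coefficient matrix A becomes B A B^T. *)
Lemma quad_op_lsub n N (B : 'M[K]_(n, N)) A u :
  quad_op A (lsub B u) = lsub B (quad_op (B *m A *m B^T) u).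
Proof.
rewrite /quad_op rmorph_sum /=.
transitivity (\sum_k \sum_l \sum_i \sum_j
    (A k l * B i l * B j k) *: lsub B (u^`M(i))^`M(j)).
  apply: eq_bigr => k _; apply: eq_bigr => l _.
  rewrite mderiv_lsub (raddf_sum (mderiv k)) /= scaler_sumr;
    apply: eq_bigr => i _ /=.
  rewrite mderivZ mderiv_lsub !scaler_sumr; apply: eq_bigr => j _.
  by rewrite !scalerA.
transitivity (\sum_j \sum_i \sum_l \sum_k
    (A k l * B i l * B j k) *: lsub B (u^`M(i))^`M(j)).
  under eq_bigr => k _ do rewrite exchange_big.
  rewrite exchange_big /=.
  under eq_bigr => i _ do under eq_bigr => k _ do rewrite exchange_big.
  under eq_bigr => i _ do rewrite exchange_big.
  rewrite exchange_big /=; apply: eq_bigr => j _; apply: eq_bigr => i _.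
  by rewrite exchange_big.
apply: eq_bigr => j _; rewrite rmorph_sum; apply: eq_bigr => i _ /=.
rewrite lsubZ mxE scaler_suml; apply: eq_bigr => l _.
rewrite !mxE mulr_suml scaler_suml; apply: eq_bigr => k _.
by congr (_ *: _); ring.
Qed.

Lemma dhomog_lsub n N (B : 'M[K]_(n, N)) d u :
  u \is d.-homog -> lsub B u \is d.-homog.
Proof.
move=> homu; rewrite /lsub /mmap big_seq; apply: rpred_sum => m um.
rewrite mul_mpolyC; apply: dhomogZ.
have <- : mdeg m = d := dhomog_mf homu um; rewrite mdegE /mmap1.
apply: (big_ind2 (fun (p : {mpoly K[N]}) e => p \is e.-homog)).
- exact: dhomog1.
- by move=> p e q e' hp hq; apply: dhomogM.
move=> i _; rewrite -[X in X.-homog]mul1n; apply: dhomogMn.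
by apply: rpred_sum => k _; apply: dhomogZ; rewrite dhomogX /= mdeg1.
Qed.

Lemma iter_quad_op_lsub n N (B : 'M[K]_(n, N)) A m u :
  iter m (quad_op A) (lsub B u) = lsub B (iter m (quad_op (B *m A *m B^T)) u).
Proof. by elim: m => //= m ->; rewrite quad_op_lsub. Qed.

End LinearSubstitution.

Section Transfer.

Variables (R : realType) (n N : nat) (A : 'M[R[i]]_n) (A' : 'M[R[i]]_N).
Variables (B : 'M[R[i]]_(n, N)) (C : 'M[R[i]]_(N, n)).
Hypotheses (BA'B : B *m A' *m B^T = A) (BC : B *m C = 1%:M).

Lemma lsub_inj : injective (lsub B).
Proof. by apply: (can_inj (g := lsub C)) => u; rewrite lsub_comp BC lsub1. Qed.

Lemma iter_quad_op_eq0 m u :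
  iter m (quad_op A') (lsub B u) = 0 <-> iter m (quad_op A) u = 0.
Proof.
rewrite iter_quad_op_lsub BA'B; split=> [|->]; last exact: rmorph0.
by rewrite -(rmorph0 (lsub B)) => /lsub_inj.
Qed.

(** The right inverse [C] of [B] makes the substitution injective, so nilpotency and vanishing mean
    the same for u and for its image, which stays homogeneous. *)
Lemma HVC_transfer : HVC (quad_op A') -> HVC (quad_op A).
Proof.
move=> hvc u [d homu] nilu; have [|m m_gt0|M van] := hvc (lsub B u).
- by exists d; apply: dhomog_lsub.
- by rewrite -(rmorphXn (lsub B)); apply/iter_quad_op_eq0/nilu.
exists M => m leMm; apply/iter_quad_op_eq0.
by rewrite rmorphXn; apply: van.
Qed.

End Transfer.

(** * Orthonormal families for a symmetric bilinear form *)

Section QuadraticForms.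

Variable K : numClosedFieldType.

(** Polarization: if all A_ii vanish, the form takes the value 2 A_ij at e_i + e_j. *)
Lemma symmetric_anisotropic N (A : 'M[K]_N) :
  A^T = A -> A != 0 -> exists v : 'rV[K]_N, (v *m A *m v^T) 0 0 != 0.
Proof.
move=> symA; pose e i : 'rV[K]_N := delta_mx 0 i.
have entry i j : (e i *m A *m (e j)^T) 0 0 = A i j.
  by rewrite trmx_delta -colE mxE -rowE mxE.
case: (boolP [exists i, A i i != 0]) => [/existsP[i Aii] _ | /existsPn A0
  A_neq0].
  by exists (e i); rewrite entry.
have [i [j Aij]] : exists i j, A i j != 0.
  have /existsP[i /existsP[j Aij]] : [exists i, exists j, A i j != 0].
    apply: contraNT A_neq0 => /existsPn A_eq0; apply/eqP/matrixP => i j.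
    by have /existsPn/(_ j)/negPn/eqP := A_eq0 i; rewrite mxE.
  by exists i, j.
have diag0 k : A k k = 0 by apply/eqP/negPn.
exists (e i + e j).
have addE (X Y : 'M[K]_1) : (X + Y) 0 0 = X 0 0 + Y 0 0 by rewrite mxE.
rewrite [(_ + _)^T]linearD /= mulmxDr !mulmxDl.
rewrite !addE !entry !diag0 addr0 add0r.
have -> : A j i = A i j by rewrite -{1}symA mxE.
by rewrite -mulr2n mulrn_eq0.
Qed.

(** Gram-Schmidt: a vector of nonzero value is normalized by a square root, and passing to its
    orthogonal complement lowers the rank by at most one. *)
Lemma orthonormal_rows N (A : 'M[K]_N) m : A^T = A -> (m <= \rank A)%N ->
  exists D : 'M[K]_(m, N), D *m A *m D^T = 1%:M.
Proof.
elim: m A => [|m IH] A symA rkA.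
  by exists 0; apply/matrixP => -[].
have A_neq0 : A != 0 by rewrite -mxrank_eq0 -lt0n (leq_trans _ rkA).
have [u qu] := symmetric_anisotropic symA A_neq0.
pose c := (u *m A *m u^T) 0 0; pose v := (sqrtC c)^-1 *: u.
have qv : v *m A *m v^T = 1%:M.
  rewrite [LHS]mx11_scalar; congr (_%:M).
  rewrite /v linearZ /= -!scalemxAl -scalemxAr scalerA mxE.
  by rewrite -invfM -expr2 sqrtCK mulVf.
(* [Q] sends x to x - (x A v^T) v, the projection along v onto its orthogonal complement; [A1] is
   the form pulled back by [Q]. *)
pose Q : 'M[K]_N := 1%:M - A *m v^T *m v.
pose A1 := A - A *m v^T *m v *m A.
have QA : Q *m A = A1 by rewrite mulmxBl mul1mx.
have symA1 : A1^T = A1.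
  by rewrite /A1 linearB /= !trmx_mul trmxK symA !mulmxA.
have vAQ : v *m A *m Q^T = 0.
  rewrite /Q linearB /= trmx1 !trmx_mul trmxK symA mulmxBr mulmx1.
  by rewrite !mulmxA qv mul1mx subrr.
have QT : Q^T = 1%:M - v^T *m (v *m A).
  by rewrite /Q linearB /= trmx1 !trmx_mul trmxK symA.
have A1v : A1 *m v^T = 0.
  rewrite mulmxBl -2!(mulmxA (A *m v^T)) qv mulmx1.
  exact: subrr.
have QAQ : Q *m A *m Q^T = A1.
  by rewrite QA QT mulmxBr mulmx1 (mulmxA A1) A1v mul0mx subr0.
have rkA1 : (m <= \rank A1)%N.
  have : (\rank A <= \rank A1 + \rank (A *m v^T *m v *m A))%N.
    by rewrite -{1}(subrK (A *m v^T *m v *m A) A) mxrank_add.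
  have : (\rank (A *m v^T *m v *m A) <= 1)%N.
    by rewrite -!mulmxA mulmxA (leq_trans (mxrankM_maxr _ _)) // rank_leq_row.
  lia.
have [D DA1] := IH _ symA1 rkA1.
change (exists E : 'M[K]_(1 + m, N), E *m A *m E^T = 1%:M).
exists (col_mx v (D *m Q)); rewrite tr_col_mx mul_col_mx mul_col_row.
have vADQ : v *m A *m (D *m Q)^T = 0.
  by rewrite trmx_mul mulmxA vAQ mul0mx.
have DQAv : D *m Q *m A *m v^T = 0.
  by rewrite -!mulmxA (mulmxA Q) QA A1v mulmx0.
rewrite qv vADQ DQAv scalar_mx_block; congr block_mx.
by rewrite trmx_mul mulmxA -2!(mulmxA D) QAQ.
Qed.

End QuadraticForms.

(** * Reduction to one quadratic form, and homogenization *)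

Section QuadraticTransfer.

Variable R : realType.
Local Notation C := R[i].

(** Three transfers: from A' to the unit form in 2n variables, then to the hyperbolic form, then to
    A. The doubled size leaves room for a singular A: the block 1 in (1, A/2) keeps the substitution
    injective. *)
Lemma HVC_quad_op N (A' : 'M[C]_N) n (A : 'M[C]_n) :
  A'^T = A' -> A^T = A -> (n + n <= \rank A')%N ->
  HVC (quad_op A') -> HVC (quad_op A).
Proof.
move=> symA' symA rkA' hvc.
have [D DA'D] := orthonormal_rows symA' rkA'.
have two_neq0 : (2%:R : C) != 0 by rewrite pnatr_eq0.
have hvc1 : HVC (quad_op (1%:M : 'M[C]_(n + n))).
  (* The relation D A' D^T = 1 itself exhibits A' D^T as a right inverse of D. *)
  by apply: (HVC_transfer (B := D) (C := A' *m D^T)) hvc => //; rewrite mulmxA.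
(* A = (1, A/2) W (1, A/2)^T for the hyperbolic form W, and W = F F^T. *)
pose F : 'M[C]_(n + n) := block_mx 1%:M ('i)%:M (2^-1)%:M (- ('i / 2))%:M.
pose W : 'M[C]_(n + n) := block_mx 0 1%:M 1%:M 0.
(* The rows of [F] form dual pairs of isotropic vectors e + i f and (e - i f) / 2. *)
have FF : F *m F^T = W.
  rewrite /F /W tr_block_mx !tr_scalar_mx mulmx_block -!scalar_mxM -!raddfD /=.
  rewrite !mul1r !mulr1.
  have ii : 'i * 'i = -1 :> C by rewrite -expr2 sqrCi.
  have e1 : 1 + 'i * 'i = 0 :> C by rewrite ii subrr.
  have e2 : 2^-1 + 'i * - ('i / 2) = 1 :> C.
    by rewrite mulrN mulrA ii; field.
  have e3 : 2^-1 + - ('i / 2) * 'i = 1 :> C by rewrite mulrC e2.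
  have e4 : 2^-1 / 2 + - ('i / 2) * - ('i / 2) = 0 :> C.
    by rewrite mulrNN mulrACA ii mulN1r subrr.
  by rewrite e1 e2 e3 e4 !raddf0.
have WW : W *m W = 1%:M.
  rewrite /W mulmx_block !mul0mx !mulmx0 !mul1mx !addr0 !add0r.
  by rewrite -scalar_mx_block.
have hvcW : HVC (quad_op W).
  apply: (HVC_transfer (B := F) (C := F^T *m W)) hvc1; first by rewrite mulmx1.
  by rewrite mulmxA FF.
apply: (HVC_transfer (B := row_mx 1%:M (2^-1 *: A)) (C := col_mx 1%:M 0)) hvcW.
  rewrite /W tr_row_mx mul_row_block !mulmx0 !mulmx1 add0r addr0.
  rewrite mul_row_col trmx1 mulmx1 mul1mx linearZ /= symA -scalerDl.
  by rewrite (_ : 2^-1 + 2^-1 = 1 :> C) ?scale1r //; field.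
by rewrite mul_row_col mulmx1 mulmx0 addr0.
Qed.

End QuadraticTransfer.

Section Dehomogenization.

Variables (K : comNzRingType) (n : nat).
Local Notation A := {mpoly K[n]}.
Local Notation A1 := {mpoly K[n + 1]}.

Definition dehom_var (k : 'I_(n + 1)) : A := if split k is inl i then 'X_i else
  1.

Definition dehom : A1 -> A :=
  mmap (@mpolyC n K) dehom_var.
HB.instance Definition _ := GRing.RMorphism.copy dehom
  (mmap (@mpolyC n K) dehom_var).

Lemma dehom_l i : dehom 'X_(lshift 1 i) = 'X_i.
Proof. by rewrite /dehom mmapU /dehom_var -[lshift 1 i]/(unsplit (inl i))
  unsplitK. Qed.

Lemma dehom_r i : dehom 'X_(rshift n i) = 1.
Proof. by rewrite /dehom mmapU /dehom_var -[rshift n i]/(unsplit (inr i))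
  unsplitK. Qed.

Lemma dehomC a : dehom a%:MP = a%:MP.
Proof. exact: mmapC. Qed.

Lemma mderiv_dehom j Q : (dehom Q)^`M(j) = dehom Q^`M(lshift 1 j).
Proof.
rewrite /dehom (@mmap_chain _ _ _ (mderiv j)) => [||a].
- rewrite /dehom_var big_split_ord /= [X in _ + X]big1 ?addr0 => [|i _].
    rewrite (bigD1 j) //= big1 => [|i neq_ij].
      rewrite -[lshift 1 j]/(unsplit (inl j)) unsplitK mderivU eqxx mulr1.
      by rewrite addr0.
    rewrite -[lshift 1 i]/(unsplit (inl i)) unsplitK mderivU (negPf neq_ij).
    by rewrite mulr0.
  rewrite -[rshift n i]/(unsplit (inr i)) unsplitK -mpolyC1 mderivC.
  by rewrite mulr0.
- exact: mderiv_leibniz.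
- exact: mderivC.
Qed.

Lemma dehom_quad_op (M : 'M[K]_n) Q :
  dehom (quad_op (block_mx M 0 0 0) Q) = quad_op M (dehom Q).
Proof.
rewrite /quad_op big_split_ord /= [X in _ + X]big1 ?addr0 => [|i _].
  rewrite rmorph_sum; apply: eq_bigr => i _.
  rewrite big_split_ord /= [X in _ + X]big1 ?addr0 => [|j _].
    rewrite rmorph_sum; apply: eq_bigr => j _ /=.
    by rewrite block_mxEul -!mul_mpolyC (rmorphM dehom) /= dehomC !mderiv_dehom.
  by rewrite block_mxEur mxE scale0r.
rewrite big1 // => j _.
by case: (split_ordP j) => {}j ->;
  rewrite ?(block_mxEdl, block_mxEdr) mxE scale0r.
Qed.

Definition mrestr (m : 'X_{1..n + 1}) : 'X_{1..n} := [multinom m (lshift 1 i) |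
  i < n].

Lemma dehomX m : dehom 'X_[m] = 'X_[mrestr m].
Proof.
rewrite /dehom mmapX /mmap1 /dehom_var big_split_ord /= [X in _ * X]big1 ?mulr1
  => [|i _].
  rewrite mpolyXE_id; apply: eq_bigr => i _.
  by rewrite -[lshift 1 i]/(unsplit (inl i)) unsplitK mnmE.
by rewrite -[rshift n i]/(unsplit (inr i)) unsplitK expr1n.
Qed.

Lemma mrestr_inj m m' : mdeg m = mdeg m' -> mrestr m = mrestr m' -> m = m'.
Proof.
move=> eq_deg /mnmP eq_restr.
have eq_l i : m (lshift 1 i) = m' (lshift 1 i) by have := eq_restr i;
  rewrite !mnmE.
apply/mnmP => k; case: (split_ordP k) => i -> //.
move: eq_deg; rewrite !mdegE !big_split_ord /= !big_ord1 (eq_bigr _ (fun i _ =>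
  eq_l i)).
by rewrite (ord1 i) => /addnI.
Qed.

(** Among monomials of one fixed degree the last exponent is determined by the others, so setting
    the last variable to 1 causes no cancellation. *)
Lemma dehom_eq0 d Q : Q \is d.-homog -> dehom Q = 0 -> Q = 0.
Proof.
move=> homQ Q0; apply/mpolyP => m; rewrite mcoeff0; apply/eqP/negPn/negP => Qm.
have : (dehom Q)@_(mrestr m) = Q@_m; last by rewrite Q0 mcoeff0 => E;
  rewrite -E eqxx in Qm.
have supp_m : m \in msupp Q by rewrite mcoeff_msupp.
rewrite {1}[Q]mpolyE rmorph_sum /= raddf_sum /= (bigD1_seq m) //= big_seq_cond.
rewrite big1 => [|k /andP[supp_k neq_km]].
  by rewrite -mul_mpolyC (rmorphM dehom) /= dehomC dehomX mcoeffCM mcoeffX eqxx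
    mulr1 addr0.
rewrite -mul_mpolyC (rmorphM dehom) /= dehomC dehomX mcoeffCM mcoeffX.
case: eqP => [/mrestr_inj eq_km|_]; last by rewrite mulr0.
case/negP: neq_km; apply/eqP/eq_km.
by rewrite [LHS](dhomog_mf homQ supp_k) [RHS](dhomog_mf homQ supp_m).
Qed.

(** The truncated predecessor is harmless at d = 0: the derivative of a constant is 0, which is
    homogeneous of every degree. *)
Lemma dhomog_mderiv N (p : {mpoly K[N]}) d i : p \is d.-homog -> p^`M(i) \is
  d.-1.-homog.
Proof.
move=> homp; apply/dhomogP => m; rewrite mcoeff_msupp mcoeff_deriv => pm.
have supp_m : (m + U_(i))%MM \in msupp p.
  by rewrite mcoeff_msupp; apply: contraNneq pm => ->; rewrite mul0rn.
by have /= <- := dhomog_mf homp supp_m; rewrite mdegD mdeg1 addn1.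
Qed.

Lemma dhomog_quad_op N (M : 'M[K]_N) p d : p \is d.-homog ->
  quad_op M p \is d.-2.-homog.
Proof.
move=> homp; apply: rpred_sum => i _; apply: rpred_sum => j _.
by apply: dhomogZ; do 2![apply: dhomog_mderiv].
Qed.

Lemma homogenization (P : A) : exists d Q, Q \is d.-homog /\ dehom Q = P.
Proof.
(* For nonzero P, [msize P] is the degree plus one, so Q carries one extra factor s; this disappears
   at s = 1. *)
pose d := msize P; pose s : A1 := 'X_(rshift n ord0).
have homX N (k : 'I_N) e : ('X_k : {mpoly K[N]}) ^+ e \is e.-homog.
  by rewrite -[X in X.-homog]mul1n; apply: dhomogMn; rewrite dhomogX /= mdeg1.
have hom_l (m : 'X_{1..n}) : \prod_(i < n) ('X_(lshift 1 i) : A1) ^+ m i \is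
  (mdeg m).-homog.
  rewrite mdegE; apply: (big_ind2 (fun (p : A1) e => p \is e.-homog)).
  - exact: dhomog1.
  - by move=> p e q e' hp hq; apply: dhomogM.
  - by move=> i _; apply: homX.
exists d, (\sum_(m <- msupp P)
    P@_m *: ((\prod_(i < n) 'X_(lshift 1 i) ^+ m i) * s ^+ (d - mdeg m))).
split.
  rewrite big_seq; apply: rpred_sum => m supp_m; apply: dhomogZ.
  rewrite -[X in X.-homog](subnKC (ltnW (msize_mdeg_lt supp_m))).
  by apply: dhomogM; [apply: hom_l | apply: homX].
rewrite [RHS]mpolyE rmorph_sum; apply: eq_bigr => m _ /=.
rewrite -!mul_mpolyC (rmorphM dehom) /= dehomC (rmorphM dehom) rmorphXn /=.
rewrite dehom_r expr1n mulr1 rmorph_prod mpolyXE_id; congr (_ * _).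
by apply: eq_bigr => i _; rewrite rmorphXn /= dehom_l.
Qed.

End Dehomogenization.

(* The homogenizing variable is not differentiated by the operator. *)
Lemma VC_of_HVC (R : realType) n (M : 'M[R[i]]_n) :
  HVC (quad_op (block_mx M 0 0 (0 : 'M_1))) -> VC (quad_op M).
Proof.
move=> hvc P nilP; have [d [Q [homQ QP]]] := homogenization P.
have dehom_iter m k : dehom (iter m (quad_op (block_mx M 0 0 (0 : 'M_1))) (Q ^+
  k)) =
    iter m (quad_op M) (P ^+ k).
  elim: m => [|m IH] /=; first by rewrite rmorphXn /= QP.
  by rewrite dehom_quad_op IH.
have [|m m_gt0|N van] := hvc Q; first by exists d.
  (* The iterates stay homogeneous, so their vanishing can be tested after dehomogenization. *)
  have [e hom_e] : exists e,
      iter m (quad_op (block_mx M 0 0 (0 : 'M_1))) (Q ^+ m) \is e.-homog.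
    elim: {1}m => [|k [e IH]]; first by exists (d * m)%N; apply: dhomogMn.
    by exists e.-2; apply: dhomog_quad_op.
  by apply: (dehom_eq0 hom_e); rewrite dehom_iter nilP.
by exists N => m leNm; rewrite -dehom_iter van // rmorph0.
Qed.

(** * Polynomial inverses *)

Section NormalizedInverse.

Variables (K : numFieldType) (n : nat).
Local Notation A := {mpoly K[n]}.
Local Notation B := {poly {mpoly K[n]}}.
Local Notation msub g := (mmap (@mpolyC n K) g).

Hypothesis vanish : forall N (H : 'I_N -> {mpoly K[N]}),
  (forall m, (0 < m)%N -> div_iter H m 1 = 0) ->
  exists M, forall m i, (M <= m)%N -> div_iter H m (H i) = 0.

(* u(z) |-> u(t z) *)
Definition scaling : A -> B := mmap (@bcst K n) (fun i => 'X * bvar K i).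
HB.instance Definition _ := GRing.RMorphism.copy scaling
  (mmap (@bcst K n) (fun i => 'X * bvar K i)).

Lemma scalingU i : scaling 'X_i = 'X * bvar K i.
Proof. exact: mmapU. Qed.

Lemma scalingC a : scaling a%:MP = bcst n a.
Proof. exact: mmapC. Qed.

Lemma bderiv_scaling j u : bderiv j (scaling u) = 'X * scaling u^`M(j).
Proof.
rewrite /scaling (@mmap_chain _ _ _ (bderiv j)) => [||a].
- rewrite (bigD1 j) //= big1 => [|i neq_ij].
    by rewrite bderivXM bderivC mderivU eqxx addr0 mulr1 mulrC.
  by rewrite bderivXM bderivC mderivU (negPf neq_ij) !mulr0.
- exact: bderiv_leibniz.
- by rewrite /= /bcst /= bderivC mderivC.
Qed.

Lemma scaling_coef0 u : (scaling u)`_0 = (u@_0)%:MP.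
Proof.
rewrite -horner_coef0.
apply: (eq_rmorph_mpoly (f := horner_eval 0 \o scaling)
  (f' := @mpolyC n K \o mcoeff 0%MM)) => [a|i] /=.
  by rewrite scalingC horner_evalE hornerC mcoeffC eqxx mulr1.
by rewrite scalingU horner_evalE hornerM hornerX mul0r mcoeffX mnm1_eq0 mpolyC0.
Qed.

Lemma scaling_coef1 u : (scaling u)`_1 = \sum_k (u^`M(k))@_0 *: 'X_k.
Proof.
rewrite -[LHS]mulr1n -coef_deriv /scaling (@mmap_chain _ _ _ (@deriv A)) =>
  [||a].
- rewrite coef_sum; apply: eq_bigr => k _.
  by rewrite /= derivM derivX derivC mulr0 addr0 mul1r coefMC scaling_coef0
    mul_mpolyC.
- exact: deriv_leibniz.
- exact: derivC.
Qed.

Lemma bsubU (G : 'I_n -> B) i : bsub G (bvar K i) = G i.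
Proof. exact: pevalU. Qed.

Lemma bsubX (G : 'I_n -> B) : bsub G 'X = 'X.
Proof. exact: pevalX. Qed.

Lemma bsubC (G : 'I_n -> B) a : bsub G (a%:MP)%:P = (a%:MP)%:P.
Proof. exact: pevalCC. Qed.

Lemma bsub_comp (F G : 'I_n -> B) p :
  bsub F (bsub G p) = bsub (fun i => bsub F (G i)) p.
Proof.
apply: (eq_rmorph_poly_mpoly (f := bsub F \o bsub G)
  (f' := bsub (fun i => bsub F (G i)))) => [a|i|] /=.
- by rewrite !bsubC.
- by rewrite !bsubU.
- by rewrite !bsubX.
Qed.

Lemma bsub_id p : bsub (@bvar K n) p = p.
Proof.
elim/poly_mpoly_ring_ind: p => [a|i||p q IHp IHq|p q IHp IHq].
- exact: bsubC.
- exact: bsubU.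
- exact: bsubX.
- by rewrite (rmorphD (bsub _)) /= IHp IHq.
- by rewrite (rmorphM (bsub _)) /= IHp IHq.
Qed.

Definition at1 : B -> A := peval (@mpolyC n K) (fun i => 'X_i) 1.
HB.instance Definition _ :=
  GRing.RMorphism.copy at1 (peval (@mpolyC n K) (fun i => 'X_i) 1).

Lemma at1U i : at1 (bvar K i) = 'X_i.
Proof. exact: pevalU. Qed.

Lemma at1X : at1 'X = 1.
Proof. exact: pevalX. Qed.

Lemma at1C a : at1 (a%:MP)%:P = a%:MP.
Proof. exact: pevalCC. Qed.

Lemma at1_scaling u : at1 (scaling u) = u.
Proof.
apply: (eq_rmorph_mpoly (f := at1 \o scaling) (f' := idfun)) => [a|i] /=.
  by rewrite scalingC at1C.
by rewrite scalingU (rmorphM at1) /= at1X at1U mul1r.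
Qed.

Lemma at1_bsub (G : 'I_n -> B) p : at1 (bsub G p) = msub (at1 \o G) (at1 p).
Proof.
apply: (eq_rmorph_poly_mpoly (f := at1 \o bsub G)
  (f' := mmap (@mpolyC n K) (at1 \o G) \o at1)) => [a|i|] /=.
- by rewrite bsubC at1C mmapC.
- by rewrite bsubU at1U mmapU.
- by rewrite bsubX at1X rmorph1.
Qed.

Variable f : 'I_n -> A.
Hypothesis f0 : forall i, (f i)@_0 = 0.
Hypothesis df0 : forall i j, ((f i)^`M(j))@_0 = (i == j)%:R.
Hypothesis det_f : \det (mxjac f) = 1.

(** The Jacobian matrix of f(t z) / t is Jf at t z, hence unimodular. [flow_inverse] inverts this
    family polynomially in t, and t = 1 gives the inverse of f. *)
Lemma normalized_inverse : exists g : 'I_n -> A,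
  (forall i, msub g (f i) = 'X_i) /\ (forall i, msub f (g i) = 'X_i).
Proof.
(* f(t z) / t = z - t h(z, t) *)
pose h i := - drop_poly 2 (scaling (f i)).
have hE i : scaling (f i) = 'X * bvar K i - 'X^2 * h i.
  rewrite mulrN opprK; apply/polyP => -[|[|m]].
  - by rewrite scaling_coef0 f0 coefD coefXM coefXnM addr0.
  - rewrite scaling_coef1 coefD coefXM coefXnM addr0 coefC (bigD1 i) //= big1.
      by rewrite df0 eqxx scale1r addr0.
    by move=> j neq_ji; rewrite df0 eq_sym (negPf neq_ji) scale0r.
  by rewrite coefD coefXM coefXnM coefC add0r coef_drop_poly subn2 addn2.
have det_h : \det (1%:M - 'X *: \matrix_(i, j) bderiv j (h i)) = 1.
  transitivity (\det (map_mx scaling (mxjac f)));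
    last by rewrite det_map_mx det_f rmorph1.
  congr (\det _); apply/matrixP => i j; rewrite !mxE.
  (* Division by t is replaced by cancelling the nonzero factor t. *)
  have X_neq0 : 'X != 0 :> B by rewrite polyX_eq0.
  apply: (mulfI X_neq0); rewrite -bderiv_scaling hE raddfB /= expr2 -mulrA.
  by rewrite !bderivXM bderivC mderivU polyC_natr mulrBr.
have [G fixG] := flow_inverse vanish det_h.
(* G(z - t h) solves the same fixpoint equation as z, so G is also a left
   inverse. *)
pose flow i := bvar K i - 'X * h i.
have bsub_flowG i : bsub flow (G i) = bvar K i.
  pose W i := bsub flow (G i); apply/subr0_eq/modX_all => M.
  apply: (@fixpoint_unique _ _ flow h M W (@bvar K n)) => {}i; last first.
    by rewrite bsub_id subrK subrr; apply: modX0.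
  rewrite -bsub_comp {1}/W fixG (rmorphD (bsub flow)) (rmorphM (bsub flow)) /=.
  by rewrite bsubU bsubX subrr; apply: modX0.
have at1h i : at1 (h i) = 'X_i - f i.
  rewrite -[f i]at1_scaling hE rmorphB !rmorphM /= !at1X at1U !mul1r.
  by rewrite opprB addrC subrK.
have at1flow i : at1 (flow i) = f i.
  by rewrite rmorphB rmorphM /= at1X at1U at1h mul1r opprB addrC subrK.
exists (at1 \o G); split => i.
  have := congr1 at1 (fixG i).
  rewrite rmorphD rmorphM /= at1X at1U mul1r at1_bsub at1h rmorphB /= mmapU /=.
  move: (mmap _ _ _) (at1 _) 'X_i => y g x /esym Exgy; apply/esym/subr0_eq.
  by have -> : x - y = x + (g - y) - g; [ring | rewrite Exgy subrr].
have := congr1 at1 (bsub_flowG i); rewrite at1_bsub at1U => <-.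
by apply: eq_mmap => k /=; rewrite at1flow.
Qed.

End NormalizedInverse.

Section PolynomialInverse.

Variables (K : numFieldType) (n : nat).
Local Notation A := {mpoly K[n]}.
Local Notation msub g := (mmap (@mpolyC n K) g).

Hypothesis vanish : forall N (H : 'I_N -> {mpoly K[N]}),
  (forall m, (0 < m)%N -> div_iter H m 1 = 0) ->
  exists M, forall m i, (M <= m)%N -> div_iter H m (H i) = 0.

Lemma msub_comp (F G : 'I_n -> A) p :
  msub F (msub G p) = msub (fun i => msub F (G i)) p.
Proof.
apply: (eq_rmorph_mpoly (f := msub F \o msub G)
  (f' := msub (fun i => msub F (G i)))) => [a|i] /=.
  by rewrite !mmapC.
by rewrite !mmapU.
Qed.

Lemma msubZ (G : 'I_n -> A) a p : msub G (a *: p) = a *: msub G p.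
Proof. by rewrite mmapZ mul_mpolyC. Qed.

(** The linear part L = JF(0) has determinant 1, and L^-1 F is tangent to the identity; if g inverts
    L^-1 F, then g composed with L^-1 inverts F. *)
Lemma unimodular_inverse (F : 'I_n -> A) :
  (forall i, (F i)@_0 = 0) -> \det (mxjac F) = 1 ->
  exists g : 'I_n -> A,
    (forall i, msub g (F i) = 'X_i) /\ (forall i, msub F (g i) = 'X_i).
Proof.
move=> F0 det_F; pose L := map_mx (mcoeff 0%MM) (mxjac F).
have det_L : \det L = 1 by rewrite det_map_mx det_F rmorph1.
have unitL : L \in unitmx by rewrite unitmxE det_L unitr1.
pose M := invmx L; pose f i := \sum_j M i j *: F j.
have mderiv_f i k : (f i)^`M(k) = \sum_j M i j *: (F j)^`M(k).
  by rewrite /f raddf_sum; apply: eq_bigr => j _; rewrite /= mderivZ.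
have f0 i : (f i)@_0 = 0.
  by rewrite raddf_sum big1 // => j _; rewrite /= mcoeffZ F0 mulr0.
have df0 i k : ((f i)^`M(k))@_0 = (i == k)%:R.
  have <- : (1%:M : 'M[K]_n) i k = (i == k)%:R by rewrite mxE.
  rewrite -(mulVmx unitL) mderiv_f raddf_sum mxE; apply: eq_bigr => j _.
  by rewrite /= mcoeffZ !mxE.
have det_f : \det (mxjac f) = 1.
  have -> : mxjac f = map_mx (@mpolyC n K) M *m mxjac F.
    apply/matrixP => i k; rewrite !mxE mderiv_f; apply: eq_bigr => j _.
    by rewrite !mxE mul_mpolyC.
  by rewrite det_mulmx det_F mulr1 det_map_mx det_inv det_L invr1 rmorph1.
have [g [fg gf]] := normalized_inverse vanish f0 df0 det_f.
exists (fun i => lsub M (g i)); split => i.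
  have -> : F i = \sum_j L i j *: f j.
    under eq_bigr => j _ do rewrite scaler_sumr.
    rewrite exchange_big /= (bigD1 i) //= [X in _ + X]big1 => [|k neq_ki].
      rewrite addr0; under eq_bigr => j _ do rewrite scalerA.
      rewrite -scaler_suml (_ : \sum_j _ = (L *m M) i i); last by rewrite mxE.
      by rewrite mulmxV // mxE eqxx scale1r.
    under eq_bigr => j _ do rewrite scalerA.
    rewrite -scaler_suml (_ : \sum_j _ = (L *m M) i k); last by rewrite mxE.
    by rewrite mulmxV // mxE eq_sym (negPf neq_ki) scale0r.
  have lsub_f j : msub (fun i => lsub M (g i)) (f j) = lsub M 'X_j.
    by rewrite -(fg j) [lsub M _]msub_comp.
  rewrite rmorph_sum /=.
  under eq_bigr => j _ do rewrite msubZ lsub_f -lsubZ.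
  by rewrite -(rmorph_sum (lsub M)) -(lsubU L) /= lsub_comp mulmxV // lsub1.
rewrite [msub F _]msub_comp -(gf i); apply: eq_mmap => j.
by rewrite rmorph_sum; apply: eq_bigr => k _; rewrite /= msubZ mmapU.
Qed.

(** Substituting polynomials without constant term preserves the constant term. *)
Lemma inverse_coef0 (F : 'I_n -> A) p i :
  (forall j, (F j)@_0 = 0) -> msub F p = 'X_i -> p@_0 = 0.
Proof.
move=> F0 FpX; have : (msub F p)@_0 = p@_0; last first.
  by move=> <-; rewrite FpX mcoeffX mnm1_eq0.
have -> : (msub F p)@_0 = ((p@_0)%:MP : A)@_0;
  last by rewrite mcoeffC eqxx mulr1.
apply: (eq_rmorph_mpoly (f := mcoeff 0%MM \o msub F)
  (f' := mcoeff 0%MM \o @mpolyC n K \o mcoeff 0%MM)) => [a|j] /=.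
  by rewrite mmapC !mcoeffC eqxx !mulr1.
by rewrite mmapU F0 mcoeffC mcoeffX mnm1_eq0 mul0r.
Qed.

End PolynomialInverse.

(** * Order of vanishing and composition of power series *)

Section FormalComposition.

Variables (K : comNzRingType).

Definition order_ge n k (p : {mpoly K[n]}) := forall m, (mdeg m < k)%N -> p@_m
  = 0.

Lemma order_geM n a b (p q : {mpoly K[n]}) :
  order_ge a p -> order_ge b q -> order_ge (a + b) (p * q).
Proof.
move=> op oq m ltm; rewrite mcoeffM big1 // => k /eqP mE.
have [lta|lea] := ltnP (mdeg k.1) a; first by rewrite op // mul0r.
rewrite oq ?mulr0 // -(ltn_add2l (mdeg k.1)) -mdegD -mE.
by apply: leq_trans ltm _; rewrite leq_add2r.
Qed.

Lemma order_ge_ideal n k : ideal_like (@order_ge n k).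
Proof.
split=> [p q op oq m ltm|p q oq]; first by rewrite mcoeffD op // oq // addr0.
by rewrite -[k]add0n; apply: order_geM.
Qed.

(** A monomial of degree d becomes a product of d factors of order at least 1. *)
Lemma order_ge_msub n N k (q : 'I_n -> {mpoly K[N]}) p :
  (forall i, (q i)@_0 = 0) -> order_ge k p -> order_ge k (mmap (@mpolyC N K) q
    p).
Proof.
move=> q0 op; rewrite /mmap big_seq; have [oD oM] := @order_ge_ideal N k.
apply: (big_ind (@order_ge N k)) => [m _|//|m supp_m]; first by rewrite mcoeff0.
apply: oM; have lekm : (k <= mdeg m)%N.
  by rewrite leqNgt; apply/negP => /op pm;
    rewrite mcoeff_msupp pm eqxx in supp_m.
suff: order_ge (mdeg m) (mmap1 q m) by move=> om l ltl;
  apply/om/(leq_trans ltl).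
rewrite mdegE /mmap1;
  apply: (big_ind2 (fun e (r : {mpoly K[N]}) => order_ge e r)) => //.
  by move=> e r e' r'; apply: order_geM.
move=> i _; elim: (m i) => [//|e IHe]; rewrite exprS -add1n;
  apply: order_geM => //.
by move=> l; rewrite ltnS leqn0 mdeg_eq0 => /eqP ->.
Qed.

End FormalComposition.

Section FormalSeries.

Variable R : realType.

Lemma fps_trunc_mpoly n k (p : {mpoly R[i][n]}) :
  order_ge k (fps_trunc k (fps_of_mpoly p) - p).
Proof.
move=> m ltm; rewrite mcoeffB raddf_sum /= (bigD1 (BMultinom ltm)) //= big1.
  by rewrite mcoeffZ mcoeffX eqxx mulr1 addr0 subrr.
move=> m' neq_m; rewrite mcoeffZ mcoeffX; case: eqP => [eq_m|_];
  last by rewrite mulr0.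
by case/eqP: neq_m; apply/val_inj.
Qed.

(** Truncation changes p and the q_i only by terms of order greater than [mdeg m]. As the q_i have
    no constant term, neither change reaches the coefficient at m. *)
Lemma fps_comp_mpoly n N (p : {mpoly R[i][n]}) (q : 'I_n -> {mpoly R[i][N]}) m :
  (forall i, (q i)@_0 = 0) ->
  fps_comp (fps_of_mpoly p) (fun i => fps_of_mpoly (q i)) m =
  (mmap (@mpolyC N R[i]) q p)@_m.
Proof.
move=> q0; rewrite /fps_comp /comp_mpoly; set k := (mdeg m).+1.
set p' := fps_trunc k _; set t := tnth _.
have ideal_k := @order_ge_ideal R[i] N k.
have tq i : order_ge k (t i - q i) by rewrite /t tnth_mktuple;
  apply: fps_trunc_mpoly.
have trunc_q : order_ge k (mmap (@mpolyC N R[i]) t p' - mmap (@mpolyC N R[i]) q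
  p').
  by apply: (mmap_congr _ _ ideal_k) => // l _; rewrite mcoeff0.
have trunc_p : order_ge k (mmap (@mpolyC N R[i]) q (p' - p)).
  by apply: order_ge_msub => //; apply: fps_trunc_mpoly.
have := ideal_k.1 _ _ trunc_q trunc_p m (ltnSn _).
by rewrite rmorphB /= addrA subrK mcoeffB => /subr0_eq.
Qed.

End FormalSeries.

(** * The theorem *)

Section VanishingJacobian.

Variable R : realType.
Local Notation C := R[i].

Lemma eq_VC n (L L' : {mpoly C[n]} -> {mpoly C[n]}) : L =1 L' -> VC L -> VC L'.
Proof.
move=> LL' vc P nilP; have eq_it m := eq_iter LL' m.
have [m m_gt0|M van] := vc P; first by rewrite eq_it nilP.
by exists M => m leMm; rewrite -eq_it van.
Qed.

Lemma eq_HVC n (L L' : {mpoly C[n]} -> {mpoly C[n]}) : L =1 L' -> HVC L -> HVC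
  L'.
Proof.
move=> LL' vc P homP nilP; have eq_it m := eq_iter LL' m.
have [//|m m_gt0|M van] := vc P; first by rewrite eq_it nilP.
by exists M => m leMm; rewrite -eq_it van.
Qed.

Lemma D2_opE n (a : nat -> nat -> C) : quad_op (D2_mx n a) =1 D2_op a.
Proof.
move=> P; apply: eq_bigr => i _; apply: eq_bigr => j _.
by rewrite mxE.
Qed.

Lemma laplacianE n : quad_op (1%:M : 'M[C]_n) =1 @laplacian R n.
Proof.
move=> P; apply: eq_bigr => i _; rewrite (bigD1 i) //= big1 => [|j neq_ji].
  by rewrite mxE eqxx scale1r addr0.
by rewrite mxE eq_sym (negPf neq_ji) scale0r.
Qed.

Lemma D2_mx_sym n N (a : nat -> nat -> C) : D2_in N a -> (D2_mx n a)^T = D2_mx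
  n a.
Proof. by case=> syma _; apply/matrixP => i j; rewrite !mxE. Qed.

Hypothesis vc : forall n (M : 'M[C]_n), M^T = M -> VC (quad_op M).

(** P = sum_l w_l H_l is nilpotent for Lambda because S_m(1) = 0. Then VC kills sum_l w_l S_m(H_l)
    for large m, and d/dw_i isolates S_m(H_i). *)
Lemma div_iter_vanishing n (H : 'I_n -> {mpoly C[n]}) :
  (forall m, (0 < m)%N -> div_iter H m 1 = 0) ->
  exists M, forall m i, (M <= m)%N -> div_iter H m (H i) = 0.
Proof.
(* The blocks are 1/2 because a symmetric matrix counts each d/dz_i d/dw_i twice. *)
move=> H1; pose h : 'M[C]_n := (2^-1)%:M.
pose W : 'M[C]_(n + n) := block_mx 0 h h 0.
have symW : W^T = W by rewrite /W tr_block_mx !trmx0 tr_scalar_mx.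
have WE : quad_op W =1 @hyperbolic_lap C n.
  move=> P; rewrite /quad_op big_split_ord /=.
  have half i : h i i = 2^-1 by rewrite mxE eqxx.
  have ul i : \sum_(j < n + n) W (lshift n i) j *: (P^`M(j))^`M(lshift n i) =
      2^-1 *: (P^`M(rshift n i))^`M(lshift n i).
    rewrite big_split_ord /= [X in X + _]big1 ?add0r => [|j _].
      rewrite (bigD1 i) //= [X in _ + X]big1 => [|j neq_ji].
        by rewrite block_mxEur half addr0.
      by rewrite block_mxEur mxE eq_sym (negPf neq_ji) scale0r.
    by rewrite block_mxEul mxE scale0r.
  have dr i : \sum_(j < n + n) W (rshift n i) j *: (P^`M(j))^`M(rshift n i) =
      2^-1 *: (P^`M(rshift n i))^`M(lshift n i).
    rewrite big_split_ord /= [X in _ + X]big1 ?addr0 => [|j _].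
      rewrite (bigD1 i) //= [X in _ + X]big1 => [|j neq_ji].
        by rewrite block_mxEdl half addr0 mderiv_comm.
      by rewrite block_mxEdl mxE eq_sym (negPf neq_ji) scale0r.
    by rewrite block_mxEdr mxE scale0r.
  rewrite (eq_bigr _ (fun i _ => ul i)) (eq_bigr _ (fun i _ => dr i))
    -big_split.
  apply: eq_bigr => i _ /=; rewrite -scalerDl.
  by rewrite (_ : 2^-1 + 2^-1 = 1 :> C) ?scale1r //; field.
have [m m_gt0|M van] := eq_VC WE (vc symW) (P := cotangent_poly H).
  by rewrite iter_hyperbolic_cotangent0 H1 // rmorph0 mul0rn.
exists M => m i leMm; have := congr1 (mderiv (rshift n i)) (van m leMm).
rewrite iter_hyperbolic_cotangent1 mderiv0 raddf_sum (bigD1 i) //= big1.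
  rewrite addr0 raddfMn /= mderivM mderivU eqxx mderiv_linj_r mulr0 mul1r addr0.
  rewrite -scaler_nat => /eqP.
  rewrite scaler_eq0 pnatr_eq0 -(negbK (_ == 0%N)) -lt0n fact_gt0 /= => /eqP.
  by rewrite -(rmorph0 (@linj C n)) => /(can_inj (@linjK C n)).
move=> j neq_ji; rewrite raddfMn /= mderivM mderivU mderiv_linj_r mulr0 addr0.
by rewrite eq_rshift (negPf neq_ji) mul0r mul0rn.
Qed.

Lemma VC_JC : JC R.
Proof.
move=> n F _ jacF; pose c i := tnth F i - ((tnth F i)@_0)%:MP.
have c0 i : (c i)@_0 = 0 by rewrite mcoeffB mcoeffC eqxx mulr1 subrr.
have det_c : \det (mxjac c) = 1.
  rewrite -[RHS]jacF; congr (\det _); apply/matrixP => i j.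
  by rewrite !mxE mderivB mderivC subr0.
have [g [gc cg]] := unimodular_inverse div_iter_vanishing c0 det_c.
have g0 i : (g i)@_0 = 0 by apply: inverse_coef0 c0 (cg i).
exists (fun i => fps_of_mpoly (g i)); last by move=> i; exists (g i).
by split=> [//|i m|i m]; rewrite fps_comp_mpoly // ?cg ?gc.
Qed.

End VanishingJacobian.

Theorem proposition2p10 (R : realType) (nu : nat -> nat)
    (Lambda : nat -> (nat -> nat -> R[i]))
    (nu_gt0 : forall k : nat, (1 <= k)%N -> (0 < nu k)%N)
    (nu_incr : forall k l : nat, (1 <= k)%N -> (k < l)%N -> (nu k < nu l)%N)
    (Lambda_D2 : forall k : nat, (1 <= k)%N -> D2 (Lambda (nu k)))
    (Lambda_rank : forall k : nat, (1 <= k)%N -> D2_rank (Lambda (nu k)) (nu k))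
    (Lambda_HVC : forall k : nat, (1 <= k)%N ->
       exists N : nat, [/\ (nu k <= N)%N,
                           D2_in N (Lambda (nu k))
                         & HVC (@D2_op R N (Lambda (nu k)))]) :
  [/\ JC R,
      forall n : nat, (1 <= n)%N -> HVC (@laplacian R n),
      forall n : nat, (1 <= n)%N -> VC (@laplacian R n),
      forall (n : nat) (a : nat -> nat -> R[i]),
        (1 <= n)%N -> D2_in n a -> HVC (@D2_op R n a)
    & forall (n : nat) (a : nat -> nat -> R[i]),
        (1 <= n)%N -> D2_in n a -> VC (@D2_op R n a)].
Proof.
(* Strict growth makes the ranks unbounded, so they exceed every 2n. *)
have nu_ge k : (k <= nu k)%N.
  elim: k => // k IH; case: k IH => [|k] IH; first exact: nu_gt0.
  exact: leq_ltn_trans IH (nu_incr _ _ _ _).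
have hvc n (M : 'M[R[i]]_n) : M^T = M -> HVC (quad_op M).
  (* The index 2n + 1 is positive even for n = 0, and the rank there is at least 2n + 1. *)
  move=> symM; have [|N [_ inN hvcN]] := Lambda_HVC (n + n).+1; first by [].
  have rkN : \rank (D2_mx N (Lambda (nu (n + n).+1))) = nu (n + n).+1.
    by apply: (D2_rank_unique (a := Lambda (nu (n + n).+1)));
      [exists N | exact: Lambda_rank].
  apply: (HVC_quad_op (D2_mx_sym N inN) symM).
    by rewrite rkN (leq_trans (leqnSn _)).
  by apply: eq_HVC hvcN => P; rewrite D2_opE.
have vc n (M : 'M[R[i]]_n) : M^T = M -> VC (quad_op M).
  (* Bordering M by zeros gives a symmetric matrix in one more variable, to which [hvc] applies as
     well. *)
  move=> symM; apply/VC_of_HVC/hvc.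
  by rewrite tr_block_mx symM !trmx0.
split.
- exact: VC_JC vc.
- by move=> n _; apply: eq_HVC (hvc _ _ (trmx1 _ _)); apply: laplacianE.
- by move=> n _; apply: eq_VC (vc _ _ (trmx1 _ _)); apply: laplacianE.
- by move=> n a _ ina; apply: eq_HVC (hvc _ _ (D2_mx_sym n ina)); apply: D2_opE.
- by move=> n a _ ina; apply: eq_VC (vc _ _ (D2_mx_sym n ina)); apply: D2_opE.
Qed.
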